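(* Let $m\le n$ and let $A\in\mathbb{R}^{n\times n}$, $B\in\mathbb{R}^{n\times m}$, $C\in\mathbb{R}^{m\times n}$, $D\in\mathbb{R}^{m\times m}$ be such that $(A,B,C,D)$ is a minimal state-space realization of a square real-rational proper $m\times m$ transfer function matrix $G(s)$. Then $G(s)$ is lossless negative imaginary if and only if $D=D^{T}$ and there exists a real matrix $P=P^{T}\ge 0$, $P\in\mathbb{R}^{n\times n}$, such that $$\begin{pmatrix} PA+A^{T}P & PB-A^{T}C^{T}\\ B^{T}P-CA & CB+(CB)^{T}\end{pmatrix}=0.$$
   Context: $A^{T}$, $\bar A$ and $A^{*}$ denote the transpose, complex conjugate and complex conjugate transpose of a matrix; $P\ge 0$ means symmetric positive semidefinite. $(A,B,C,D)$ is a realization of $G$ if $G(s)=C(sI-A)^{-1}B+D$; it is minimal if $(A,B)$ is controllable and $(A,C)$ is observable. A square real-rational transfer function matrix $G(s)$ (a square matrix of rational functions with real coefficients) is negative imaginary if: (1) $G(s)$ has no poles in $\mathrm{Re}[s]>0$; (2) $j[G(j\omega)-G^{*}(j\omega)]\ge 0$ for all $\omega>0$ except values of $\omega$ where $j\omega$ is a pole of $G(s)$; (3) if $s=0$ is a pole of $G(s)$, then it is at most a double pole, $\lim_{s\to 0}s^{2}G(s)$ is positive semidefinite Hermitian, and $\lim_{s\to 0}s^{m}G(s)=0$ for all $m\ge 3$; (4) if $s=j\omega_0$ with $\omega_0>0$ finite is a pole of $G(s)$, it is at most a simple pole and $K=\lim_{s\to j\omega_0}(s-j\omega_0)jG(s)$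 is positive semidefinite Hermitian; (5) if $s=j\infty$ is a pole of $G(s)$, then it is at most a double pole, $\lim_{\omega\to\infty}G(j\omega)/(j\omega)^2$ is negative semidefinite Hermitian, and $\lim_{\omega\to\infty}G(j\omega)/(j\omega)^m=0$ for all $m\ge 3$. A square real-rational $G(s)$ is lossless negative imaginary if it is negative imaginary and $j[G(j\omega)-G^{*}(j\omega)]=0$ for all $\omega>0$ except values of $\omega$ where $j\omega$ is a pole of $G(s)$. *)

(* Defs.v *)
From HB Require Import structures.
From mathcomp Require Import all_boot all_order all_algebra.
From mathcomp Require Import complex.
From mathcomp Require Import all_classical all_reals all_analysis.

Set Implicit Arguments.
Unset Strict Implicit.
Unset Printing Implicit Defensive.

Import Order.TTheory GRing.Theory Num.Theory.
Import numFieldNormedType.Exports.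

Local Open Scope classical_set_scope.
Local Open Scope ring_scope.
Local Open Scope complex_scope.
Local Open Scope sesquilinear_scope.

(* The topology of R[i] is the one given by its modulus; matrices over R[i]
   then carry the library's (entrywise) matrix topology. *)
Set Warnings "-redundant-canonical-projection".
#[non_forgetful_inheritance]
HB.instance Definition _ (R : rcfType) := PseudoPointedMetric.copy R[i] R[i]^o.

(* A real-rational transfer function matrix is a matrix over the field of
   fractions of {poly R}. *)
Notation ratfun R := {fraction {poly R}}.

Section Ratfun.
Variable R : realType.
Implicit Type f : ratfun R.

Definition rnum f : {poly R} := (repr f).1 %/ gcdp (repr f).1 (repr f).2.
Definition rden f : {poly R} := (repr f).2 %/ gcdp (repr f).1 (repr f).2.

Let repr_neq0 f : (repr f).2 != 0 := denom_ratioP (repr f).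

Lemma rden_neq0 f : rden f != 0.
Proof. by rewrite dvdp_div_eq0 ?dvdp_gcdr. Qed.

Lemma coprimep_rnum_rden f : coprimep (rnum f) (rden f).
Proof. by rewrite coprimep_div_gcd // repr_neq0 orbT. Qed.

Lemma rnum_rdenE f : f = tofrac (rnum f) / tofrac (rden f).
Proof.
have fE : tofrac (repr f).1 = f * tofrac (repr f).2.
  rewrite -[X in _ = X * _]reprK; unlock tofrac; rewrite -[RHS]FracField.pi_mul.
  apply/eqmodP; rewrite /= FracField.equivfE /FracField.mulf.
  by rewrite !numden_Ratio ?oner_neq0 ?mulr1 ?repr_neq0 ?mul1r.
have g0 : gcdp (repr f).1 (repr f).2 != 0.
  by rewrite gcdp_eq0 negb_and repr_neq0 orbT.
have d0 := rden_neq0 f.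
apply: (canRL (mulfK _)); first by rewrite tofrac_eq0.
apply: (@mulIf _ (tofrac (gcdp (repr f).1 (repr f).2))).
  by rewrite tofrac_eq0.
rewrite -mulrA -!tofracM.
by rewrite /rnum /rden !divpK ?dvdp_gcdl ?dvdp_gcdr.
Qed.

Definition cpoly (p : {poly R}) : {poly R[i]} := map_poly (real_complex R) p.

(* When s is a pole of f the value is the junk 0 of division by zero. *)
Definition rval f (s : R[i]) : R[i] :=
  (cpoly (rnum f)).[s] / (cpoly (rden f)).[s].

End Ratfun.

Section TransferMatrix.
Variables (R : realType) (m : nat).
Implicit Type G : 'M[ratfun R]_m.

Definition tfval G (s : R[i]) : 'M[R[i]]_m := map_mx (fun f => rval f s) G.

(* The order of s as a pole of G is the largest order of s as a pole of an
   entry of G; it is 0 when s is not a pole. *)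
Definition pole_order G (s : R[i]) : nat :=
  \max_(i < m) \max_(j < m) mup s (cpoly (rden (G i j))).

Definition is_pole G s := (0 < pole_order G s)%N.

(* The subtraction is truncated, so an entry that is proper contributes 0. *)
Definition pole_order_infty G : nat :=
  \max_(i < m) \max_(j < m) (size (rnum (G i j)) - size (rden (G i j)))%N.

Definition is_pole_infty G := (0 < pole_order_infty G)%N.

Definition proper_tf G :=
  forall i j, (size (rnum (G i j)) <= size (rden (G i j)))%N.

Definition psd_hermitian (M : 'M[R[i]]_m) :=
  M ^t* = M /\ forall x : 'cV[R[i]]_m, 0 <= (x ^t* *m M *m x) 0 0.

Definition jw (w : R) : R[i] := 0 +i* w.

Definition jskew G (w : R) : 'M[R[i]]_m :=
  'i%C *: (tfval G (jw w) - (tfval G (jw w)) ^t*).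

Definition negative_imaginary G :=
  [/\ forall s : R[i], 0 < complex.Re s -> ~~ is_pole G s,
      forall w : R, 0 < w -> ~~ is_pole G (jw w) -> psd_hermitian (jskew G w),
      is_pole G 0 ->
        [/\ (pole_order G 0%R <= 2)%N,
            exists2 K : 'M[R[i]]_m,
              s ^+ 2 *: tfval G s @[s --> (0 : R[i])^'] --> K
              & psd_hermitian K
          & forall k, (3 <= k)%N ->
              s ^+ k *: tfval G s @[s --> (0 : R[i])^'] --> (0 : 'M[R[i]]_m)],
      forall w0 : R, 0 < w0 -> is_pole G (jw w0) ->
        (pole_order G (jw w0) <= 1)%N /\
        exists2 K : 'M[R[i]]_m,
          (s - jw w0) *: ('i%C *: tfval G s) @[s --> (jw w0)^'] --> K
          & psd_hermitian K
    & is_pole_infty G ->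
        [/\ (pole_order_infty G <= 2)%N,
            exists2 K : 'M[R[i]]_m,
              (jw w ^+ 2)^-1 *: tfval G (jw w) @[w --> +oo] --> K
              & psd_hermitian (- K)
          & forall k, (3 <= k)%N ->
              (jw w ^+ k)^-1 *: tfval G (jw w) @[w --> +oo]
                --> (0 : 'M[R[i]]_m)]].

Definition lossless_negative_imaginary G :=
  negative_imaginary G /\
  forall w : R, 0 < w -> ~~ is_pole G (jw w) -> jskew G w = 0.

End TransferMatrix.

Section StateSpace.
Variables (R : realType) (m n : nat).
Variables (A : 'M[R]_n) (B : 'M[R]_(n, m)) (C : 'M[R]_(m, n)) (D : 'M[R]_m).

Definition rconst (a : R) : ratfun R := tofrac a%:P.

Definition realization (G : 'M[ratfun R]_m) :=
  G = map_mx rconst C *m invmx ((tofrac 'X)%:M - map_mx rconst A)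
        *m map_mx rconst B + map_mx rconst D.

Definition controllable := \rank (\mxrow_(k < n) (A ^+ k *m B)) = n.

Definition observable := \rank (\mxcol_(k < n) (C *m A ^+ k)) = n.

Definition minimal_realization (G : 'M[ratfun R]_m) :=
  [/\ realization G, controllable & observable].

End StateSpace.

Definition psd_symmetric (R : realType) (n : nat) (P : 'M[R]_n) :=
  P = P^T /\ forall x : 'cV[R]_n, 0 <= (x^T *m P *m x) 0 0.

(* Main.v *)
Require Import Defs.
From mathcomp Require Import all_boot all_order all_algebra.
From mathcomp Require Import complex ring.
From mathcomp Require Import all_classical all_reals all_analysis.

Set Implicit Arguments.
Unset Strict Implicit.
Unset Printing Implicit Defensive.

Import Order.TTheory GRing.Theory Num.Theory.
Import numFieldNormedType.Exports.

Local Open Scope classical_set_scope.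
Local Open Scope ring_scope.
Local Open Scope complex_scope.
Local Open Scope sesquilinear_scope.

(* Losslessness on the imaginary axis is the identity
   G(s) = G(-s)^T, that is D = D^T together with the equality of the Markov parameters of
   (A, B, C) and (-A^T, C^T, -B^T). Both being minimal, there is a similarity T with
   T A = -A^T T and T B = C^T, and by uniqueness T is skew-symmetric. Then P = -T A is
   symmetric and satisfies the three matrix equations; what is left is P >= 0.
   The form x^* P y has A as a skew-adjoint, so the generalized eigenspaces of A are
   orthogonal to each other, and by minimality the denominators of G annihilate A; hence all
   eigenvalues lie on the imaginary axis, are semisimple outside 0, and A^2 vanishes on the
   generalized kernel. If Z is the spectral projection of B at iw <> 0 (resp. at 0), then
   lim (s - iw) i G(s) = w^-1 Z^* P Z (resp. lim s^2 G(s) = Z^* P Z), and controllability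
   shows that the columns of Z span the eigenspace (resp. span the generalized kernel up to
   a subspace of ker P): the residue conditions say exactly that P >= 0 on each piece.
   Conversely, given P, an eigenvector argument using observability shows that A has this
   same spectral structure, and the same two formulas give the residue conditions. *)

(** * Limits of rational matrix functions *)

Lemma cvg_mx_entry (T : ptopologicalType) (X : Type) (F : set_system X) (m n : nat)
  (f : X -> 'M[T]_(m, n)) (M : 'M[T]_(m, n)) :
  Filter F -> (forall i j, f x i j @[x --> F] --> M i j) -> f @ F --> M.
Proof.
move=> FF fM A [B nB sBA].
have H : \forall x \near F, forall i j, B i j (f x i j).
  apply: filter_forall => i; apply: filter_forall => j.
  exact: (fM i j _ (nB i j)).
by apply: filterS H => x Bx; apply: sBA.
Qed.

Lemma mx_entry_cvg (T : ptopologicalType) (X : Type) (F : set_system X) (m n : nat)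
  (f : X -> 'M[T]_(m, n)) (M : 'M[T]_(m, n)) i j :
  Filter F -> f @ F --> M -> f x i j @[x --> F] --> M i j.
Proof.
move=> FF fM B nB; apply: (fM [set N | B (N i j)]).
exists (fun i' j' => if (i' == i) && (j' == j) then B else setT) => [i' j'|N].
  by case: ifP => [/andP[/eqP -> /eqP ->] //|_]; exact: filterT.
by move=> /(_ i j); rewrite !eqxx.
Qed.

Lemma cvg_horner (K : numFieldType) (p : {poly K}) (x : K) : horner p @ x --> p.[x].
Proof.
elim/poly_ind: p => [|p c IH].
  have -> : horner (0 : {poly K}) = cst 0 by apply/funext => y; rewrite horner0.
  exact: (@cvg_cst K 0 K (nbhs x) _).
have -> : horner (p * 'X + c%:P) = (fun y => p.[y] * y + c).
  by apply/funext => y; rewrite !hornerE.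
have FF : Filter (nbhs x) by exact: nbhs_filter.
have pX := @cvgM K K (nbhs x) FF (horner p) id _ _ IH (@cvg_id K (nbhs x)).
exact: (@cvgD K K K (nbhs x) FF _ _ _ _ pX (@cvg_cst K c K (nbhs x) FF)).
Qed.

Lemma horner_neq0_near (K : numFieldType) (p : {poly K}) (x : K) : p.[x] != 0 ->
  \forall y \near x, p.[y] != 0.
Proof.
move=> px; have FF : Filter (nbhs x) by exact: nbhs_filter.
exact: (@cvgr_neq0 K K _ (nbhs x) FF (horner p) _ (@cvg_horner _ p x) px).
Qed.

(** Evaluation at a pole returns a junk value, so [F] is constrained only where [s != l] and [p]
    does not vanish. As [p.[l] != 0], this covers a punctured neighbourhood of [l], and continuity
    of polynomials gives the limit. *)
Lemma cvg_rational_mx (K : numFieldType) m n (W : 'M[{poly K}]_(m, n))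
    (p : {poly K}) (l : K) (F : K -> 'M[K]_(m, n)) :
  p.[l] != 0 ->
  (forall s, s != l -> p.[s] != 0 -> F s = p.[s]^-1 *: map_mx (horner^~ s) W) ->
  F s @[s --> l^'] --> p.[l]^-1 *: map_mx (horner^~ l) W.
Proof.
move=> pl FE.
have FF : Filter l^' by exact: dnbhs_filter.
have H q : q.[s] @[s --> l^'] --> q.[l].
  apply: cvg_trans (@cvg_horner _ q l).
  by apply: cvg_app; exact: nbhs_dnbhs.
suff : p.[s]^-1 *: map_mx (horner^~ s) W @[s --> l^'] -->
       p.[l]^-1 *: map_mx (horner^~ l) W.
  apply: cvg_trans; apply: near_eq_cvg.
  have nl : \forall s \near l^', s != l by exact: nbhs_dnbhs_neq.
  have pn : \forall s \near l^', p.[s] != 0.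
    exact: (nbhs_dnbhs (horner_neq0_near pl)).
  exact: (@filterS2 _ _ FF _ _ _ (fun s sl ps => esym (FE s sl ps)) nl pn).
apply: cvg_mx_entry => i j.
have -> : (fun s => (p.[s]^-1 *: map_mx (horner^~ s) W) i j) =
          ((fun s => p.[s]^-1) \* horner (W i j)).
  by apply/funext => s; rewrite !mxE.
have -> : (p.[l]^-1 *: map_mx (horner^~ l) W) i j = p.[l]^-1 * (W i j).[l].
  by rewrite !mxE.
apply: (@cvgM K K l^' FF _ _ _ _ _ (H _)).
exact: (@cvgV K K l^' FF _ _ pl (H p)).
Qed.

(** Used to identify the abstract limit [K] in the pole conditions with an explicitly computed
    one. *)
Lemma cvg_mx_unique (K : numFieldType) (l : K) m n (F : K -> 'M[K]_(m, n))
    (M N : 'M[K]_(m, n)) :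
  F s @[s --> l^'] --> M -> F s @[s --> l^'] --> N -> M = N.
Proof.
have FF : ProperFilter l^' by exact: Proper_dnbhs_numFieldType.
move=> FM FN; apply/matrixP => i j.
have FF' : Filter l^' by exact: dnbhs_filter.
apply: (@cvg_unique K (@norm_hausdorff _ K) ((fun s => F s i j) @ l^')).
- exact: (@mx_entry_cvg K K l^' m n F M i j FF' FM).
- exact: (@mx_entry_cvg K K l^' m n F N i j FF' FN).
Qed.

(** * Resolvents, Markov parameters and minimality *)

Section Resolvent.
Variables (F : fieldType) (n : nat).
Implicit Types (A : 'M[F]_n.+1) (p : {poly F}).

(** [N] is the quotient of [p(x) - p(A)] by [x - A]. When [p] annihilates [A], [N / p] is the
    resolvent, and the size bound makes it strictly proper. *)
Lemma resolvent_numerator A p : exists N : 'M[{poly F}]_n.+1,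
  [/\ char_poly_mx A *m N = p%:M - map_mx polyC (horner_mx A p),
      N *m char_poly_mx A = p%:M - map_mx polyC (horner_mx A p)
    & forall i j, (size (N i j) <= (size p).-1)%N].
Proof.
elim/poly_ind: p => [|p c [N [NAl NAr Ns]]].
  exists 0; rewrite mulmx0 mul0mx !raddf0 addr0; split=> // i j.
  by rewrite mxE size_poly0.
have hE : horner_mx A (p * 'X + c%:P) = horner_mx A p *m A + c%:M.
  by rewrite rmorphD rmorphM /= horner_mx_X horner_mx_C.
have AC : map_mx polyC A *m map_mx polyC (horner_mx A p) =
          map_mx polyC (horner_mx A p *m A).
  by rewrite -map_mxM (comm_mx_horner p (erefl : comm_mx A A)).
(* Horner recursion: for [r = p X + c], [r(x) - r(A) = x (p(x) - p(A)) + (x - A) p(A)], so the new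
   quotient is [x N + p(A)]. *)
have E : (p * 'X + c%:P)%:M - map_mx polyC (horner_mx A (p * 'X + c%:P)) =
   'X *: (p%:M - map_mx polyC (horner_mx A p)) +
   ('X *: map_mx polyC (horner_mx A p) - map_mx polyC (horner_mx A p *m A)).
  rewrite hE; apply/matrixP => i j; rewrite !mxE !polyCD.
  by case: (i == j); rewrite ?mulr1n ?mulr0n; ring.
case: (eqVneq p 0) => [p0|p0].
  exists 0; rewrite mulmx0 mul0mx; split=> [|| i j]; last by rewrite mxE size_poly0.
    by rewrite p0 mul0r add0r horner_mx_C map_scalar_mx subrr.
  by rewrite p0 mul0r add0r horner_mx_C map_scalar_mx subrr.
exists ('X *: N + map_mx polyC (horner_mx A p)); split.
- by rewrite mulmxDr -scalemxAr NAl E /char_poly_mx mulmxBl mul_scalar_mx AC.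
- by rewrite mulmxDl -scalemxAl NAr E /char_poly_mx mulmxBr mul_mx_scalar map_mxM.
move=> i j; rewrite !mxE size_MXaddC (negPf p0) /= mulrC.
apply: leq_trans (size_polyD _ _) _; rewrite geq_max; apply/andP; split; last first.
  by apply: leq_trans (size_polyC_leq1 _) _; rewrite lt0n size_poly_eq0.
apply: leq_trans (size_polyMleq _ _) _; rewrite size_polyX addn2 /=.
have : (0 < size p)%N by rewrite lt0n size_poly_eq0.
by move: (Ns i j); case: (size p).
Qed.

Lemma horner_char_poly_mx A (s : F) :
  map_mx (horner_eval s) (char_poly_mx A) = s%:M - A.
Proof.
rewrite /char_poly_mx map_mxB map_scalar_mx /= /horner_eval hornerX -map_mx_comp.
by congr (_ - _); apply/matrixP => i j; rewrite !mxE /= hornerC.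
Qed.

End Resolvent.

Section StrictlyProper.
Variable F : fieldType.

Lemma size_mulmxC (k m n1 n2 d : nat) (E : 'M[F]_(k, n1)) (N : 'M[{poly F}]_(n1, n2))
    (B : 'M[F]_(n2, m)) :
  (forall i j, (size (N i j) <= d)%N) ->
  forall i j, (size ((map_mx polyC E *m N *m map_mx polyC B) i j) <= d)%N.
Proof.
move=> Nd i j; rewrite mxE; apply: leq_trans (size_sum _ _ _) _.
apply/bigmax_leqP => l _; rewrite !mxE mulrC mul_polyC.
apply: leq_trans (size_scale_leq _ _) _; apply: leq_trans (size_sum _ _ _) _.
apply/bigmax_leqP => l' _; rewrite !mxE mul_polyC.
exact: leq_trans (size_scale_leq _ _) (Nd _ _).
Qed.

(** Uniqueness of the quotient and remainder in the division of 0 by [p]. *)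
Lemma size_split_eq0 (k m : nat) (p : {poly F}) (V W : 'M[{poly F}]_(k, m)) :
  p != 0 -> (forall i j, (size (V i j) < size p)%N) -> V + p *: W = 0 ->
  V = 0 /\ W = 0.
Proof.
move=> p0 Vp VW.
suff W0 : W = 0 by move: VW; rewrite W0 scaler0 addr0.
apply/matrixP => i j; rewrite mxE; apply/eqP; apply: contraT => Wij.
have /matrixP/(_ i j) := VW; rewrite !mxE => /eqP; rewrite addr_eq0 => /eqP Vij.
have := Vp i j; rewrite Vij size_polyN size_mul // ltnNge.
have : (0 < size (W i j))%N by rewrite lt0n size_poly_eq0.
by case: (size (W i j)) => // d _; rewrite addnS /= leq_addr.
Qed.

Variables (n k m : nat) (A : 'M[F]_n.+1) (B : 'M[F]_(n.+1, m)) (E : 'M[F]_(k, n.+1)).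

(* [E (s - A)^-1 B] is strictly proper, so it cannot cancel a nonzero polynomial [W]. *)
Lemma markov_parameters_eq0 (S : F -> Prop) (W : 'M[{poly F}]_(k, m)) :
  (forall p : {poly F}, (forall s, S s -> p.[s] = 0) -> p = 0) ->
  (forall s Y, S s -> (char_poly A).[s] != 0 -> (s%:M - A) *m Y = B ->
     E *m Y + map_mx (horner_eval s) W = 0) ->
  W = 0 /\ forall l, E *m A ^+ l *m B = 0.
Proof.
move=> Sinf EYW; set chi := char_poly A.
have chi0 : chi != 0 by exact: monic_neq0 (char_poly_monic A).
have [N [NA _ Ns]] := resolvent_numerator A chi.
rewrite Cayley_Hamilton raddf0 subr0 in NA.
have {}Ns i j : (size (N i j) <= n.+1)%N by move: (Ns i j); rewrite size_char_poly.
have sizeV (E' : 'M[F]_(k, n.+1)) i j :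
    (size ((map_mx polyC E' *m N *m map_mx polyC B) i j) < size chi)%N.
  by rewrite size_char_poly ltnS; apply: size_mulmxC.
have V0 : map_mx polyC E *m N *m map_mx polyC B + chi *: W = 0.
  apply/matrixP => i j; rewrite [RHS]mxE.
  (* The extra factor [chi] makes the identity trivial at those points of [S] that are eigenvalues
     of [A]. *)
  apply: (@mulfI _ chi) => //; rewrite mulr0; apply: Sinf => s Ss.
  rewrite hornerM; case: (eqVneq chi.[s] 0) => [->|cs]; first by rewrite mul0r.
  have := EYW s (chi.[s]^-1 *: (map_mx (horner_eval s) N *m B)) Ss cs.
  have -> : (s%:M - A) *m (chi.[s]^-1 *: (map_mx (horner_eval s) N *m B)) = B.
    rewrite -scalemxAr mulmxA -horner_char_poly_mx -map_mxM NA map_scalar_mx.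
    by rewrite mul_scalar_mx scalerA /= /horner_eval mulVf // scale1r.
  have polyCK p1 p2 (X : 'M[F]_(p1, p2)) :
    map_mx (horner_eval s) (map_mx polyC X) = X.
    by apply/matrixP => a b; rewrite !mxE /= /horner_eval hornerC.
  move=> /(_ erefl) /(congr1 (fun X => chi.[s] *: X)) /matrixP/(_ i j).
  have -> : chi.[s] *: (E *m (chi.[s]^-1 *: (map_mx (horner_eval s) N *m B)) +
     map_mx (horner_eval s) W) = map_mx (horner_eval s)
       (map_mx polyC E *m N *m map_mx polyC B + chi *: W).
    rewrite map_mxD !map_mxM !polyCK map_mxZ /= scalerDr -scalemxAr scalerA.
    by rewrite mulfV // scale1r mulmxA.
  by rewrite scaler0 !mxE /horner_eval => ->; rewrite mulr0.
have [ENB W0] := size_split_eq0 chi0 (sizeV E) V0.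
split=> // l.
suff [_ ->] : map_mx polyC (E *m A ^+ l) *m N *m map_mx polyC B = 0 /\
   E *m A ^+ l *m B = 0 by [].
(* From [x N = A N + chi], the vanishing of [E' N B] gives [E' A N B + chi E' B = 0]; again the
   first term has size below that of [chi], so both terms vanish. *)
have step (E' : 'M[F]_(k, n.+1)) : map_mx polyC E' *m N *m map_mx polyC B = 0 ->
   map_mx polyC (E' *m A) *m N *m map_mx polyC B = 0 /\ E' *m B = 0.
  move=> h.
  have [] := @size_split_eq0 k m chi (map_mx polyC (E' *m A) *m N *m map_mx polyC B)
     (map_mx polyC (E' *m B)) chi0 (sizeV _).
    have := congr1 (fun X => map_mx polyC E' *m X *m map_mx polyC B) NA.
    rewrite /char_poly_mx mulmxBl mul_scalar_mx mulmxBr mulmxBl -scalemxAr -scalemxAl.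
    rewrite h scaler0 sub0r !map_mxM mulmxA mul_mx_scalar => /eqP.
    by rewrite -scalemxAl eq_sym -addr_eq0 addrC => /eqP.
  move=> -> /matrixP H; split=> //; apply/matrixP => i j.
  by have := H i j; rewrite !mxE => /polyC_inj.
elim: l => [|l [IH1 IH2]].
  by rewrite expr0 mulmx1; split=> //; have [] := step _ ENB.
have [H _] := step _ IH1.
rewrite exprSr mulmxA in H *; split=> //.
by have [] := step _ H.
Qed.

End StrictlyProper.

Section Minimality.
Variables (F : fieldType) (n m : nat).
Implicit Types (A : 'M[F]_n.+1) (B : 'M[F]_(n.+1, m)) (C : 'M[F]_(m, n.+1)).

Lemma trmxX A l : (A ^+ l)^T = A^T ^+ l.
Proof.
elim: l => [|l IH]; first by rewrite !expr0 trmx1.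
by rewrite exprS exprSr trmx_mul IH.
Qed.

(** The [V k] are the blocks of a right inverse of the controllability matrix. *)
Lemma controllable_span A B :
  \rank (\mxrow_(k < n.+1) (A ^+ k *m B)) = n.+1 ->
  exists V : 'I_n.+1 -> 'M[F]_(m, n.+1), \sum_(k < n.+1) A ^+ k *m B *m V k = 1%:M.
Proof.
move=> rkAB; set M := \mxrow_k _ in rkAB.
have Mfree : row_free M by rewrite /row_free rkAB.
exists (submxcol (pinvmx M)).
by rewrite -mul_mxrow_mxcol submxcolK mulmxVp.
Qed.

Lemma controllable_left_eq0 A B p (X : 'M[F]_(p, n.+1)) :
  \rank (\mxrow_(k < n.+1) (A ^+ k *m B)) = n.+1 ->
  (forall l, X *m A ^+ l *m B = 0) -> X = 0.
Proof.
move=> /controllable_span[V V1] XAB.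
rewrite -[X]mulmx1 -V1 mulmx_sumr big1 // => k _.
by rewrite !mulmxA XAB mul0mx.
Qed.

Lemma observable_right_eq0 A C p (X : 'M[F]_(n.+1, p)) :
  \rank (\mxcol_(k < n.+1) (C *m A ^+ k)) = n.+1 ->
  (forall l, C *m A ^+ l *m X = 0) -> X = 0.
Proof.
rewrite -mxrank_tr tr_mxcol => rkCA CAX; apply: trmx_inj; rewrite trmx0.
apply: (@controllable_left_eq0 A^T C^T) => [|l].
  by rewrite -[RHS]rkCA; congr (\rank _); apply: eq_mxrow => k; rewrite trmx_mul trmxX.
by rewrite -trmxX -!trmx_mul mulmxA CAX trmx0.
Qed.

(** This is the state-space isomorphism between [(A, B, C)] and its para-conjugate
    [(-A^T, C^T, -B^T)], whose Markov parameters agree by hypothesis. Skew-symmetry comes from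
    uniqueness: [T^T + T] intertwines [A] with [-A^T] and kills [B], hence vanishes on every
    [A^l B]. *)
Lemma skew_similarity A B C :
  \rank (\mxrow_(k < n.+1) (A ^+ k *m B)) = n.+1 ->
  (forall l, C *m A ^+ l *m B + B^T *m (- A^T) ^+ l *m C^T = 0) ->
  exists T : 'M[F]_n.+1, [/\ T^T = - T, T *m A = - A^T *m T & T *m B = C^T].
Proof.
move=> ctr CAB.
(* Up to signs, observability of the para-conjugate system is the transpose of controllability of
   [(A, B)]. *)
have sep p (X : 'M[F]_(n.+1, p)) : (forall l, B^T *m (- A^T) ^+ l *m X = 0) -> X = 0.
  move=> BX; apply: trmx_inj; rewrite trmx0.
  apply: (@controllable_left_eq0 A B) => // l.
  apply: trmx_inj; rewrite trmx0 !trmx_mul trmxX trmxK.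
  apply/eqP; move/eqP: (BX l).
  by rewrite exprNn -signr_odd; case: (odd l);
    rewrite ?mulN1r ?mul1r ?mulmxN ?mulNmx ?oppr_eq0 ?mulmxA.
have expD (X : 'M[F]_n.+1) j l : X ^+ j *m X ^+ l = X ^+ (j + l) by rewrite exprD.
have expS (X : 'M[F]_n.+1) l : X *m X ^+ l = X ^+ l.+1 by rewrite exprS.
have expSr (X : 'M[F]_n.+1) l : X ^+ l *m X = X ^+ l.+1 by rewrite exprSr.
have [V V1] := controllable_span ctr.
(* The requirement [T A^k B = (-A^T)^k C^T] forces this formula, since the [A^k B V k] sum to the
   identity. *)
pose T := \sum_(k < n.+1) (- A^T) ^+ k *m C^T *m V k.
have BAT l : B^T *m (- A^T) ^+ l *m T = - (C *m A ^+ l).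
  rewrite -[in RHS](mulmx1 (C *m _)) -V1 !mulmx_sumr -sumrN; apply: eq_bigr => k _.
  rewrite !mulmxA -(mulmxA _ (A ^+ l)) -(mulmxA _ (_ ^+ l)) !expD -mulNmx.
  by congr (_ *m _); apply/eqP; rewrite -addr_eq0 addrC CAB.
have TAB l : T *m A ^+ l *m B = (- A^T) ^+ l *m C^T.
  apply/subr0_eq; apply: sep => j.
  rewrite mulmxBr !mulmxA BAT -(mulmxA _ (_ ^+ j)) expD !mulNmx.
  rewrite -(mulmxA _ (_ ^+ j)) expD.
  by apply/eqP; rewrite -opprD oppr_eq0 CAB.
have TA : T *m A = - A^T *m T.
  apply/subr0_eq; apply: (controllable_left_eq0 ctr) => l.
  rewrite !mulmxBl -(mulmxA T A) expS TAB.
  rewrite -(mulmxA (- A^T) T) -(mulmxA (- A^T)) TAB mulmxA expS subrr //.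
have TB : T *m B = C^T by have := TAB 0%N; rewrite !expr0 mulmx1 mul1mx.
have BT : B^T *m T = - C by have := BAT 0%N; rewrite !expr0 !mulmx1.
exists T; split=> //; apply/eqP; rewrite -addr_eq0; apply/eqP.
have SA : (T^T + T) *m A = - A^T *m (T^T + T).
  rewrite mulmxDl mulmxDr TA; congr (_ + _); apply: trmx_inj.
  by rewrite !trmx_mul !trmxK linearN /= trmxK mulmxN TA mulNmx opprK.
have SB : (T^T + T) *m B = 0.
  rewrite mulmxDl TB; apply: trmx_inj.
  by rewrite linearD /= trmx_mul !trmxK trmx0 BT addNr.
apply: (controllable_left_eq0 ctr) => l.
suff -> : (T^T + T) *m A ^+ l = (- A^T) ^+ l *m (T^T + T) by rewrite -mulmxA SB mulmx0.
elim: l => [|l IH]; first by rewrite !expr0 mulmx1 mul1mx.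
by rewrite -expSr mulmxA IH -mulmxA SA mulmxA expSr.
Qed.

End Minimality.

(** * Evaluation of a realization *)

Lemma invmx_uniq (K : comUnitRingType) n (Z X : 'M[K]_n) : Z *m X = 1%:M -> invmx Z = X.
Proof.
move=> ZX; have [uZ _] := mulmx1_unit ZX.
by rewrite -[invmx Z]mulmx1 -ZX mulKmx.
Qed.

Section Evaluation.
Variable R : realType.
Local Notation cmx := (map_mx (real_complex R)).

Lemma rnum_rden_cross (f : ratfun R) (p q : {poly R}) :
  f * tofrac q = tofrac p -> rnum f * q = p * rden f.
Proof.
move=> fq; apply/eqP; rewrite -tofrac_eq !tofracM -fq {2}(rnum_rdenE f).
apply/eqP; rewrite mulrAC -!mulrA; congr (_ * _).
by rewrite mulrA mulVf ?mul1r // tofrac_eq0 rden_neq0.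
Qed.

Lemma rden_dvdp (f : ratfun R) (p q : {poly R}) :
  f * tofrac q = tofrac p -> rden f %| q.
Proof.
move=> /rnum_rden_cross fq.
rewrite -(@Gauss_dvdpr _ _ (rnum f)) ?fq ?dvdp_mull //.
by rewrite coprimep_sym coprimep_rnum_rden.
Qed.

(** [rval] is computed from the reduced fraction; any other fraction with [q] nonzero at [s] gives
    the same value, because the reduced denominator divides [q]. *)
Lemma rvalE (f : ratfun R) (p q : {poly R}) s :
  f * tofrac q = tofrac p -> (cpoly q).[s] != 0 ->
  rval f s = (cpoly p).[s] / (cpoly q).[s].
Proof.
move=> fq qs; have /dvdpP[r qr] := rden_dvdp fq.
have ds : (cpoly (rden f)).[s] != 0.
  by apply: contraNneq qs => ds; rewrite qr /cpoly rmorphM hornerM ds mulr0.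
apply/eqP; rewrite /rval eqr_div // -!hornerM -!rmorphM /=.
by rewrite (rnum_rden_cross fq) mulrC.
Qed.

Variables (n m : nat) (A : 'M[R]_n.+1) (B : 'M[R]_(n.+1, m)) (C : 'M[R]_(m, n.+1)).
Variables (D : 'M[R]_m) (G : 'M[ratfun R]_m) (p : {poly R}).
Hypotheses (GE : realization A B C D G) (p0 : p != 0) (pA : horner_mx A p = 0).

(** Any polynomial annihilating [A] is a common denominator of [G]. This freedom allows a later
    switch from the characteristic polynomial to one whose zeros all lie on the imaginary axis. *)
Lemma realization_numerator : exists N : 'M[{poly R}]_n.+1,
  N *m char_poly_mx A = p%:M /\
  forall i j, G i j * tofrac p =
   tofrac ((map_mx polyC C *m N *m map_mx polyC B + p *: map_mx polyC D) i j).
Proof.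
have [N [NAl NAr _]] := resolvent_numerator A p.
rewrite pA !raddf0 addr0 in NAl NAr.
exists N; split=> // i j.
pose t := @tofrac {poly R}.
have tp0 : t p != 0 by rewrite tofrac_eq0.
have rc k l (X : 'M[R]_(k, l)) : map_mx (@rconst R) X = map_mx t (map_mx polyC X).
  by rewrite -map_mx_comp.
have ZN : ((t 'X)%:M - map_mx (@rconst R) A) *m ((t p)^-1 *: map_mx t N) = 1%:M.
  rewrite rc -scalemxAr -(map_scalar_mx t) -map_mxB -map_mxM NAl map_scalar_mx.
  by rewrite scale_scalar_mx mulVf.
have -> : G i j * t p = (t p *: G) i j by rewrite mxE mulrC.
have -> : t p *: G = map_mx t (map_mx polyC C *m N *m map_mx polyC B + p *: map_mx polyC D).
  rewrite GE (invmx_uniq ZN) !rc map_mxD !map_mxM map_mxZ scalerDr.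
  by rewrite -scalemxAr -scalemxAl scalerA mulfV // scale1r.
by rewrite mxE.
Qed.

Lemma realization_rden_dvdp i j : rden (G i j) %| p.
Proof. by have [N [_ GN]] := realization_numerator; apply: rden_dvdp (GN i j). Qed.

(** [Y] stands for [(s - A)^-1 B]; asking only that it solve the linear system avoids inverting
    matrices over [R[i]]. *)
Lemma realization_tfval s Y : (cpoly p).[s] != 0 ->
  (s%:M - cmx A) *m Y = cmx B -> tfval G s = cmx C *m Y + cmx D.
Proof.
move=> ps YB; have [N [NA GN]] := realization_numerator.
pose h : {poly R} -> R[i] := horner_eval s \o map_poly (real_complex R).
have hC k l (X : 'M[R]_(k, l)) : map_mx h (map_mx polyC X) = cmx X.
  apply/matrixP => i j; rewrite !mxE /h /= /horner_eval.
  by rewrite map_polyC hornerC.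
have NsA : map_mx h N *m (s%:M - cmx A) = (h p)%:M.
  rewrite -map_scalar_mx -NA map_mxM /char_poly_mx map_mxB hC map_scalar_mx /=.
  by rewrite /h /= map_polyX /horner_eval hornerX.
have NB : map_mx h N *m cmx B = h p *: Y by rewrite -YB mulmxA NsA mul_scalar_mx.
apply/matrixP => i j; rewrite mxE (rvalE (GN i j) ps).
apply: (canLR (mulfK ps)).
set W := _ + _; have -> : (cpoly (W i j)).[s] = (map_mx h W) i j by rewrite [RHS]mxE.
by rewrite map_mxD !map_mxM map_mxZ !hC -mulmxA NB -scalemxAr -scalerDr mxE mulrC.
Qed.

End Evaluation.

(** * Conjugation, polynomial identities and divisibility over the complex numbers *)

Section ImaginaryAxis.
Variable R : realType.
Local Notation cmx := (map_mx (real_complex R)).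
Implicit Types (p q : {poly R}) (s z : R[i]) (w : R).

Lemma conj_complexE z : Num.conj z = complex.Re z -i* complex.Im z.
Proof. by case: z. Qed.

Lemma conj_jw w : Num.conj (jw w) = - jw w.
Proof. by apply/eqP; rewrite conj_complexE eq_complex /= oppr0 !eqxx. Qed.

Lemma conj_real (x : R) : Num.conj x%:C = x%:C.
Proof. by rewrite conj_complexE /= oppr0. Qed.

Lemma jw_eq0 w : (jw w == 0) = (w == 0).
Proof. by rewrite eq_complex /= eqxx. Qed.

Lemma jwE w : jw w = 'i%C * w%:C.
Proof.
by apply/eqP; rewrite eq_complex /= !(mul0r, mul1r, mulr0, subr0, addr0, add0r, eqxx, oppr0).
Qed.

Lemma jw_sqr w : jw w ^+ 2 = (- w ^+ 2)%:C.
Proof. by rewrite jwE exprMn sqr_i mulN1r rmorphN rmorphXn. Qed.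

Lemma real_partE z : complex.Re z = 0 -> z = jw (complex.Im z).
Proof. by case: z => a b /= ->. Qed.

Lemma conj_cpoly p s : Num.conj (cpoly p).[s] = (cpoly p).[Num.conj s].
Proof.
rewrite -horner_map -map_poly_comp; congr (_.[_]).
by apply: eq_map_poly => x /=; rewrite conj_real.
Qed.

Lemma cpoly_eq0 p : (cpoly p == 0) = (p == 0).
Proof. exact: map_poly_eq0. Qed.

Lemma cpoly_dvdp p q : (cpoly p %| cpoly q) = (p %| q).
Proof. exact: dvdp_map. Qed.

Lemma cpolyM p q : cpoly (p * q) = cpoly p * cpoly q.
Proof. exact: rmorphM. Qed.

Lemma cmx_inj m n : injective (fun X : 'M[R]_(m, n) => cmx X).
Proof.
move=> X Y /matrixP XY; apply/matrixP => i j.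
by have := XY i j; rewrite !mxE => /complexI.
Qed.

Lemma cmx_ct m n (X : 'M[R]_(m, n)) : (cmx X)^t* = cmx X^T.
Proof. by apply/matrixP => i j; rewrite !mxE conj_real. Qed.

Lemma ctM m n k (X : 'M[R[i]]_(m, n)) (Y : 'M[R[i]]_(n, k)) :
  (X *m Y)^t* = Y^t* *m X^t*.
Proof. by rewrite trmx_mul map_mxM. Qed.

Lemma ctK m n (X : 'M[R[i]]_(m, n)) : X^t*^t* = X.
Proof. by apply/matrixP => i j; rewrite !mxE conjCK. Qed.

Lemma ctZ m n a (X : 'M[R[i]]_(m, n)) : (a *: X)^t* = Num.conj a *: X^t*.
Proof. by apply/matrixP => i j; rewrite !mxE rmorphM. Qed.

Lemma ctD m n (X Y : 'M[R[i]]_(m, n)) : (X + Y)^t* = X^t* + Y^t*.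
Proof. by apply/matrixP => i j; rewrite !mxE rmorphD. Qed.

Lemma imaginary_axis_infinite (d p : {poly R[i]}) : d != 0 ->
  (forall s, (exists w, [/\ 0 < w, s = jw w & d.[s] != 0]) -> p.[s] = 0) -> p = 0.
Proof.
move=> d0 dp.
(* The product [d * p] vanishes at [i], [2i], [3i] and so on: the points excluded by the hypothesis
   are zeros of [d]. *)
suff /eqP : d * p = 0 by rewrite mulf_eq0 (negPf d0) => /eqP.
apply: (@roots_geq_poly_eq0 _ _ (mkseq (fun k => jw (k.+1%:R : R)) (size (d * p)))).
- apply/allP => _ /mapP[k _ ->]; rewrite /root hornerM.
  have [->|dk] := eqVneq d.[jw k.+1%:R] 0; first by rewrite mul0r.
  by rewrite dp ?mulr0 //; exists k.+1%:R; split=> //; rewrite ltr0n.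
- apply/mkseq_uniqP => k l _ _ [] /eqP.
  by rewrite -/(_ == _) eqr_nat => /eqP[].
- by rewrite size_mkseq.
Qed.

(** As [R[i]] is algebraically closed, a non-constant [p] has a root; it is shared with [q], and the
    linear factor is split off both. *)
Lemma dvdp_mup (p q : {poly R[i]}) : p != 0 -> q != 0 ->
  (forall z, root p z -> (mup z p <= mup z q)%N) -> p %| q.
Proof.
move: {2}(size p) (leqnn (size p)) => k; elim: k p q => [|k IH] p q.
  by rewrite leqn0 size_poly_eq0 => ->.
move=> pk p0 q0 pq.
have [/eqP p1|p1] := eqVneq (size p) 1%N.
  by rewrite (eqp_dvdl _ (_ : p %= 1)) ?dvd1p // -size_poly_eq1.
have [z pz] := closed_rootP p p1.
have /factor_theorem[p' pE] := pz.
have /factor_theorem[q' qE] : root q z.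
  rewrite root_factor_theorem XsubC_dvd //.
  by apply: leq_trans (pq z pz); rewrite -XsubC_dvd // -root_factor_theorem.
have p'0 : p' != 0 by apply: contraNneq p0 => p'0; rewrite pE p'0 mul0r.
have q'0 : q' != 0 by apply: contraNneq q0 => q'0; rewrite qE q'0 mul0r.
have X0 y : 'X - y%:P != 0 :> {poly R[i]} by rewrite polyXsubC_eq0.
rewrite pE qE dvdp_mul2r //; apply: IH => // [|y py].
  by move: pk; rewrite pE size_Mmonic ?monicXsubC // size_XsubC addn2.
have := pq y; rewrite pE qE !mupM // leq_add2r; apply.
by rewrite rootM py.
Qed.

End ImaginaryAxis.

(** * Poles on the imaginary axis *)

Section Poles.
Variables (R : realType) (m : nat) (G : 'M[ratfun R]_m).
Implicit Types (p q : {poly R}) (s z : R[i]) (w : R).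

Lemma is_poleP s :
  reflect (exists i j, root (cpoly (rden (G i j))) s) (is_pole G s).
Proof.
have crden0 i j : cpoly (rden (G i j)) != 0 by rewrite cpoly_eq0 rden_neq0.
apply: (iffP idP) => [|[i [j Gs]]].
  apply: contraPP => nG; apply/negP; rewrite -leqNgt.
  apply/bigmax_leqP => i _; apply/bigmax_leqP => j _.
  by rewrite mupNroot //; apply/negP => Gs; apply: nG; exists i, j.
rewrite /is_pole /pole_order (bigD1 i) //= leq_max; apply/orP; left.
rewrite (bigD1 j) //= leq_max; apply/orP; left.
by rewrite -XsubC_dvd // -root_factor_theorem.
Qed.

Lemma mup_le_pole_order i j s : (mup s (cpoly (rden (G i j))) <= pole_order G s)%N.
Proof.
rewrite /pole_order (bigD1 i) //= leq_max; apply/orP; left.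
by rewrite (bigD1 j) //= leq_max leqnn.
Qed.

Lemma pole_order_le p s k : p != 0 -> (forall i j, rden (G i j) %| p) ->
  (mup s (cpoly p) <= k)%N -> (pole_order G s <= k)%N.
Proof.
move=> p0 Gp; apply: leq_trans; apply/bigmax_leqP => i _; apply/bigmax_leqP => j _.
rewrite mup_geq ?cpoly_eq0 //; apply: (@dvdp_trans _ (cpoly (rden (G i j)))).
  by rewrite -mup_geq // cpoly_eq0 rden_neq0.
by rewrite cpoly_dvdp.
Qed.

Lemma is_pole_dvdp p s : (forall i j, rden (G i j) %| p) -> is_pole G s -> root (cpoly p) s.
Proof.
move=> Gp /is_poleP[i [j]]; rewrite !root_factor_theorem => Gs.
by apply: dvdp_trans Gs _; rewrite cpoly_dvdp.
Qed.

Lemma jskew_eq0 w : (jskew G w = 0) <-> (tfval G (jw w) = (tfval G (jw w))^t*).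
Proof.
rewrite /jskew; split=> [/eqP|<-]; last by rewrite subrr scaler0.
by rewrite scaler_eq0 eq_complex /= oner_eq0 andbF /= subr_eq0 => /eqP.
Qed.

(** Real coefficients turn conjugation at [iw] into evaluation at [-iw], so the condition becomes an
    algebraic identity in [s = iw]. *)
Lemma jskew_eq0E w : (jskew G w = 0) <->
  forall i j, rval (G i j) (jw w) = rval (G j i) (- jw w).
Proof.
have cj (f : ratfun R) : Num.conj (rval f (jw w)) = rval f (- jw w).
  by rewrite /rval fmorph_div /= !conj_cpoly conj_jw.
rewrite jskew_eq0; split=> [/matrixP H i j|H].
  by have := H i j; rewrite !mxE cj.
by apply/matrixP => i j; rewrite !mxE cj.
Qed.

(* This is [G(s) = G(-s)^T] with the denominators cleared. *)
Lemma para_identity p : p != 0 -> (forall i j, rden (G i j) %| p) ->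
  (forall w, 0 < w -> (cpoly p).[jw w] != 0 -> jskew G w = 0) ->
  forall i j s, (cpoly (rnum (G i j))).[s] * (cpoly (rden (G j i))).[- s] =
                (cpoly (rnum (G j i))).[- s] * (cpoly (rden (G i j))).[s].
Proof.
move=> p0 Gp Gw i j s.
pose V := cpoly (rnum (G i j)) * (cpoly (rden (G j i)) \Po - 'X) -
          (cpoly (rnum (G j i)) \Po - 'X) * cpoly (rden (G i j)).
have VE z : V.[z] = (cpoly (rnum (G i j))).[z] * (cpoly (rden (G j i))).[- z] -
                (cpoly (rnum (G j i))).[- z] * (cpoly (rden (G i j))).[z].
  by rewrite /V !(hornerE, horner_comp).
apply/eqP; rewrite -subr_eq0 -VE.
suff -> : V = 0 by rewrite horner0.
apply: (@imaginary_axis_infinite _ (cpoly p)); first by rewrite cpoly_eq0.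
move=> _ [w [w0 -> pw]].
have nz k l : (cpoly (rden (G k l))).[jw w] != 0.
  apply: contraNneq pw => Gkl; rewrite -[_ == _]/(root _ _).
  apply: is_pole_dvdp => //; apply/is_poleP; exists k, l; exact/eqP.
have nzN k l : (cpoly (rden (G k l))).[- jw w] != 0.
  by rewrite -conj_jw -conj_cpoly conjC_eq0.
have /jskew_eq0E/(_ i j)/eqP := Gw w w0 pw.
by rewrite /rval eqr_div // VE => /eqP ->; rewrite subrr.
Qed.

(** A zero of [p] need not be a pole of [G]; the identity with cleared denominators also holds at
    such points. *)
Lemma jskew_nonpole p w : p != 0 -> (forall i j, rden (G i j) %| p) ->
  (forall w, 0 < w -> (cpoly p).[jw w] != 0 -> jskew G w = 0) ->
  ~~ is_pole G (jw w) -> jskew G w = 0.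
Proof.
move=> p0 Gp Gw nw; apply/jskew_eq0E => i j.
have nz k l : (cpoly (rden (G k l))).[jw w] != 0.
  by apply: contraNneq nw => Gkl; apply/is_poleP; exists k, l; exact/eqP.
have nzN k l : (cpoly (rden (G k l))).[- jw w] != 0.
  by rewrite -conj_jw -conj_cpoly conjC_eq0.
apply/eqP; rewrite /rval eqr_div //; apply/eqP.
exact: (para_identity p0).
Qed.

(** At a zero of the denominator of [G i j] the cleared identity makes a product vanish; the
    numerator of [G i j] is coprime to that denominator, so it is the denominator of [G j i] that
    vanishes at [- s]. *)
Lemma lossless_pole_opp p s : p != 0 -> (forall i j, rden (G i j) %| p) ->
  (forall w, 0 < w -> (cpoly p).[jw w] != 0 -> jskew G w = 0) ->
  is_pole G s -> is_pole G (- s).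
Proof.
move=> p0 Gp Gw /is_poleP[i [j Gs]]; apply/is_poleP; exists j, i.
have := para_identity p0 Gp Gw i j s.
rewrite (eqP Gs) mulr0 => /eqP; rewrite mulf_eq0 => /orP[ns|//].
have : coprimep (cpoly (rnum (G i j))) (cpoly (rden (G i j))).
  by rewrite coprimep_map coprimep_rnum_rden.
by move=> /coprimep_root/(_ ns); rewrite (eqP Gs) eqxx.
Qed.

End Poles.

(** * Even real denominators with all zeros on the imaginary axis *)

Section ImaginaryDenominator.
Variable R : realType.
Implicit Types (ws : seq R) (w : R).

(** For distinct nonnegative [ws] the zeros are the [+iw] and [-iw], simple except for a double zero
    at 0 when [0 \in ws]: exactly the multiplicities that the pole conditions allow. *)
Definition imdenom ws : {poly R} := \prod_(w <- ws) ('X^2 + (w ^+ 2)%:P).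

Lemma imdenom_neq0 ws : imdenom ws != 0.
Proof.
rewrite monic_neq0 // monic_prod // => w _.
rewrite monicE lead_coefDl ?lead_coefXn // size_polyXn.
by apply: leq_ltn_trans (size_polyC_leq1 _) _.
Qed.

Lemma imdenom_rem w ws : w \in ws ->
  imdenom ws = ('X^2 + (w ^+ 2)%:P) * imdenom (rem w ws).
Proof. by move=> ?; rewrite /imdenom (big_rem w). Qed.

Lemma imdenom_even ws : imdenom ws \Po - 'X = imdenom ws.
Proof.
rewrite /imdenom rmorph_prod; apply: eq_bigr => w _ /=.
by rewrite rmorphD /= rmorphXn /= comp_polyX comp_polyC sqrrN.
Qed.

Lemma cpoly_quadratic w : cpoly ('X^2 + (w ^+ 2)%:P) =
  ('X - (jw w)%:P) * ('X + (jw w)%:P).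
Proof.
rewrite /cpoly rmorphD /= map_polyXn map_polyC /= -subr_sqr -rmorphXn jw_sqr.
by rewrite !rmorphN opprK.
Qed.

Lemma imdenom_jw_neq0 w ws : 0 <= w -> (forall v, v \in ws -> 0 <= v) ->
  w \notin ws -> (cpoly (imdenom ws)).[jw w] != 0.
Proof.
move=> w0 ws0 wws; rewrite /cpoly rmorph_prod horner_prod prodf_seq_neq0.
apply/allP => v vws; apply/implyP => _.
rewrite /= -[map_poly _ _]/(cpoly _) cpoly_quadratic.
rewrite hornerM hornerXsubC hornerD hornerX hornerC.
have vw : v != w by apply: contraNneq wws => <-.
rewrite mulf_neq0 //; apply: contraNneq vw => /(congr1 (@complex.Im R)) /= /eqP.
  by rewrite subr_eq0 eq_sym.
by rewrite paddr_eq0 // ?ws0 // => /andP[/eqP -> /eqP ->].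
Qed.

Lemma imdenom0_neq0 ws : 0 \notin ws -> (imdenom ws).[0] != 0.
Proof.
move=> wws; rewrite horner_prod prodf_seq_neq0.
apply/allP => v vws; apply/implyP => _; rewrite !hornerE expr0n /= add0r.
by rewrite expf_neq0 //; apply: contraNneq wws => <-.
Qed.

Lemma imdenom_sim w ws : (forall v, v \in ws -> 0 <= v) -> uniq ws -> w \in ws ->
  w != 0 -> exists2 chi, cpoly (imdenom ws) = ('X - (jw w)%:P) * chi & chi.[jw w] != 0.
Proof.
move=> ws0 uws wws w0.
exists (('X + (jw w)%:P) * cpoly (imdenom (rem w ws))).
  by rewrite (imdenom_rem wws) cpolyM cpoly_quadratic mulrA.
rewrite hornerM mulf_neq0 //.
  by rewrite hornerD hornerX hornerC -mulr2n mulrn_eq0 jw_eq0.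
apply: imdenom_jw_neq0; [exact: ws0| |by rewrite mem_rem_uniqF].
by move=> v /mem_rem; apply: ws0.
Qed.

Lemma dvdp_imdenom ws p : p != 0 -> (forall v, v \in ws -> 0 <= v) ->
  (forall z, root (cpoly p) z ->
     [/\ complex.Re z = 0, `|complex.Im z| \in ws
       & (mup z (cpoly p) <= if z == 0%R then 2 else 1)%N]) ->
  p %| imdenom ws.
Proof.
move=> p0 ws0 pz; rewrite -cpoly_dvdp; apply: dvdp_mup; rewrite ?cpoly_eq0 ?imdenom_neq0 //.
move=> z /pz[/real_partE zE zws mz]; apply: leq_trans mz _.
(* The single factor with [w = |Im z|] already provides the multiplicity: it is [X^2] for [z = 0]
   and contains [X - z] otherwise. *)
rewrite mup_geq ?cpoly_eq0 ?imdenom_neq0 // (imdenom_rem zws) cpolyM.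
rewrite real_normK ?num_real // cpoly_quadratic -zE dvdp_mulr //.
case: ifP => [/eqP ->|_]; first by rewrite polyC0 addr0 subr0 expr2.
by rewrite expr1 dvdp_mulr.
Qed.

End ImaginaryDenominator.

Lemma resolvent_scale (K : fieldType) k l (a d c : K) (X Y : 'M[K]_(k, l)) :
  d != 0 -> c != 0 ->
  a *: (d *: ((d * c)^-1 *: X + Y)) = c^-1 *: (a *: (X + (d * c) *: Y)).
Proof.
move=> d0 c0; apply/matrixP => i j; rewrite !mxE; field.
by rewrite d0 c0.
Qed.

(** * Leading Laurent coefficients of a realization *)

Section Residues.
Variables (R : realType) (n m : nat).
Local Notation cmx := (map_mx (real_complex R)).
Variables (A : 'M[R]_n.+1) (B : 'M[R]_(n.+1, m)) (C : 'M[R]_(m, n.+1)).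
Variables (D : 'M[R]_m) (G : 'M[ratfun R]_m).
Hypothesis GE : realization A B C D G.

Lemma map_horner_polyC (K : comNzRingType) k l (s : K) (X : 'M[K]_(k, l)) :
  map_mx (horner_eval s) (map_mx polyC X) = X.
Proof. by apply/matrixP => a b; rewrite !mxE /= /horner_eval hornerC. Qed.

(* [chi(l)^-1 U(l)] is the coefficient of [(s - l)^-e] in the Laurent expansion of the
   resolvent of [A] at [l]. *)
Lemma tfval_cvg (p : {poly R}) (chi : {poly R[i]}) (a l : R[i]) (e : nat)
    (U : 'M[{poly R[i]}]_n.+1) (F : R[i] -> 'M[R[i]]_m) :
  horner_mx A p = 0 -> (0 < e)%N ->
  cpoly p = ('X - l%:P) ^+ e * chi -> chi.[l] != 0 ->
  char_poly_mx (cmx A) *m U =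
    ('X - l%:P) ^+ e *: map_mx polyC (horner_mx (cmx A) chi) ->
  (forall s, F s = a *: ((s - l) ^+ e *: tfval G s)) ->
  F s @[s --> l^'] -->
    a *: (chi.[l]^-1 *: (cmx C *m map_mx (horner_eval l) U *m cmx B)).
Proof.
move=> pA e0 pE chil UE FE.
have chi0 : chi != 0 by apply: contraNneq chil => ->; rewrite horner0.
have p0 : p != 0.
  by rewrite -cpoly_eq0 pE mulf_neq0 // expf_neq0 // polyXsubC_eq0.
have [N [NA _ _]] := resolvent_numerator (cmx A) chi.
(* [N] inverts [x - A] up to [chi - chi(A)], and [U] supplies the missing [(x - l)^e chi(A)]; so [M]
   is a resolvent numerator for the denominator [p], with [M(l) = U(l)]. *)
pose M := ('X - l%:P) ^+ e *: N + U.
have MA : char_poly_mx (cmx A) *m M = (('X - l%:P) ^+ e * chi)%:M.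
  by rewrite mulmxDr -scalemxAr NA UE -scalerDr subrK scale_scalar_mx.
pose W := map_mx polyC (a *: cmx C) *m M *m map_mx polyC (cmx B) +
          (('X - l%:P) ^+ e * chi) *: map_mx polyC (a *: cmx D).
have WE s : map_mx (horner^~ s) W =
    a *: (cmx C *m map_mx (horner_eval s) M *m cmx B +
    ((s - l) ^+ e * chi.[s]) *: cmx D).
  rewrite -[horner^~ s]/(horner_eval s) /W map_mxD !map_mxM !map_horner_polyC.
  rewrite map_mxZ map_horner_polyC /= /horner_eval hornerM horner_exp hornerXsubC.
  by rewrite -!scalemxAl scalerDr !scalerA mulrC.
have -> : a *: (chi.[l]^-1 *: (cmx C *m map_mx (horner_eval l) U *m cmx B)) =
          chi.[l]^-1 *: map_mx (horner^~ l) W.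
  rewrite WE subrr expr0n gtn_eqF // mul0r scale0r addr0 !scalerA mulrC.
  congr (_ *: (_ *m _ *m _)).
  rewrite /M map_mxD map_mxZ /= /horner_eval horner_exp hornerXsubC subrr expr0n gtn_eqF //.
  by rewrite scale0r add0r.
apply: cvg_rational_mx => // s sl chis.
have ps : (cpoly p).[s] != 0.
  by rewrite pE hornerM horner_exp hornerXsubC mulf_neq0 // expf_neq0 // subr_eq0.
have sle : (s - l) ^+ e != 0 by rewrite expf_neq0 // subr_eq0.
have YB : (s%:M - cmx A) *m
    (((s - l) ^+ e * chi.[s])^-1 *: (map_mx (horner_eval s) M *m cmx B)) = cmx B.
  rewrite -scalemxAr mulmxA -horner_char_poly_mx -map_mxM MA map_scalar_mx.
  rewrite mul_scalar_mx scalerA /= /horner_eval hornerM horner_exp hornerXsubC.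
  by rewrite mulVf ?scale1r // mulf_neq0.
rewrite FE (realization_tfval GE p0 pA ps YB) WE -scalemxAr mulmxA.
exact: resolvent_scale.
Qed.

End Residues.

(** * The form defined by P *)

Section HornerMx.
Variables (K : comNzRingType) (n : nat).
Implicit Types (A P X : 'M[K]_n.+1) (q : {poly K}).

Lemma horner_mxMXaddC A q c :
  horner_mx A (q * 'X + c%:P) = horner_mx A q *m A + c%:M.
Proof. by rewrite rmorphD rmorphM /= horner_mx_X horner_mx_C. Qed.

Lemma trmx_horner_mx A q : (horner_mx A q)^T = horner_mx A^T q.
Proof.
elim/poly_ind: q => [|q c IH]; first by rewrite !raddf0.
rewrite !horner_mxMXaddC linearD /= trmx_mul tr_scalar_mx IH; congr (_ + _).
exact: (comm_mx_horner q (erefl : comm_mx A^T A^T)).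
Qed.

(** With [X = A^T], [A] is skew-adjoint for the form of [P], and the adjoint of [q(A)] is
    [q(-A)]. *)
Lemma horner_mx_intertwine A P X q : X *m P + P *m A = 0 ->
  horner_mx X q *m P = P *m horner_mx A (q \Po - 'X).
Proof.
move=> XP; elim/poly_ind: q => [|q c IH]; first by rewrite !raddf0 ?mul0mx ?mulmx0.
have {}XP : X *m P = - (P *m A) by apply/eqP; rewrite -addr_eq0 XP.
rewrite comp_polyD comp_polyM comp_polyX comp_polyC mulrN.
rewrite horner_mxMXaddC mulmxDl -mulmxA XP mulmxN mulmxA IH.
rewrite rmorphD rmorphN rmorphM /= horner_mx_X horner_mx_C mulmxDr mulmxN mulmxA.
by rewrite scalar_mxC.
Qed.

Lemma horner_mx_eigen A k (Z : 'M[K]_(n.+1, k)) l q : A *m Z = l *: Z ->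
  horner_mx A q *m Z = q.[l] *: Z.
Proof.
move=> AZ; elim/poly_ind: q => [|q c IH].
  by rewrite raddf0 mul0mx horner0 scale0r.
rewrite horner_mxMXaddC mulmxDl -mulmxA AZ -scalemxAr IH mul_scalar_mx scalerA.
by rewrite hornerMXaddC scalerDl mulrC.
Qed.

End HornerMx.

Section Form.
Variables (R : realType) (n m : nat).
Local Notation cmx := (map_mx (real_complex R)).
Variables (A P : 'M[R]_n.+1) (B : 'M[R]_(n.+1, m)) (C : 'M[R]_(m, n.+1)).
Hypotheses (PA : P *m A + A^T *m P = 0) (BP : B^T *m P = C *m A).

(** Moving [q(A)] across the form gives the conjugated polynomial at [-A], which acts on the
    eigenspace as a scalar; since [-iw] is the conjugate of [iw], that scalar is the conjugate of
    [q(iw)]. *)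
Lemma form_adjoint k (X Z : 'M[R[i]]_(n.+1, k)) w (q : {poly R[i]}) :
  cmx A *m Z = jw w *: Z ->
  (horner_mx (cmx A) q *m X)^t* *m cmx P *m Z =
  Num.conj q.[jw w] *: (X^t* *m cmx P *m Z).
Proof.
move=> AZ; rewrite ctM trmx_horner_mx map_horner_mx.
have -> : map_mx Num.conj (cmx A)^T = cmx A^T by rewrite cmx_ct.
rewrite -(mulmxA (X^t*)) (@horner_mx_intertwine _ _ (cmx A)); last first.
  by rewrite -!map_mxM -map_mxD addrC PA map_mx0.
rewrite -!mulmxA (horner_mx_eigen _ AZ) -!scalemxAr horner_comp hornerN hornerX.
by rewrite -conj_jw horner_map.
Qed.

Lemma skew_eigen_form k (Z : 'M[R[i]]_(n.+1, k)) w :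
  cmx A *m Z = jw w *: Z -> jw w *: (cmx C *m Z) = (cmx B)^t* *m cmx P *m Z.
Proof.
by move=> AZ; rewrite scalemxAr -AZ mulmxA -map_mxM -BP map_mxM cmx_ct.
Qed.

(** [iw C Z = C A Z = B^T P Z], and [form_adjoint] replaces the left factor [B] by its projection
    [Z]. *)
Lemma residue_form (chi : {poly R[i]}) w (Z : 'M[R[i]]_(n.+1, m)) :
  chi.[jw w] != 0 -> chi.[jw w] *: Z = horner_mx (cmx A) chi *m cmx B ->
  cmx A *m Z = jw w *: Z ->
  jw w *: (cmx C *m Z) = Z^t* *m cmx P *m Z.
Proof.
move=> chiw ZE AZ; rewrite (skew_eigen_form AZ).
have := form_adjoint (cmx B) chi AZ; rewrite -ZE ctZ -!scalemxAl.
by move=> /(scalerI _) -> //; rewrite conjC_eq0.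
Qed.

End Form.

(** * Real positive semidefinite forms extended to complex vectors *)

Section Positivity.
Variables (R : realType) (n : nat) (P : 'M[R]_n).
Local Notation cmx := (map_mx (real_complex R)).
(** The two cross terms are opposite because [P] is real symmetric. *)
Lemma hermitian_formE (x y : 'cV[R]_n) : P = P^T ->
  (((cmx x + 'i%C *: cmx y)^t* *m cmx P *m (cmx x + 'i%C *: cmx y)) 0 0) =
  ((x^T *m P *m x) 0 0 + (y^T *m P *m y) 0 0)%:C.
Proof.
move=> PT; have ci : Num.conj ('i%C : R[i]) = - 'i%C.
  by apply/eqP; rewrite conj_complexE eq_complex /= oppr0 !eqxx.
have yPx : y^T *m P *m x = x^T *m P *m y.
  have tr1 (X : 'M[R]_1) : X^T = X by apply/matrixP => i j; rewrite !ord1 mxE.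
  by rewrite -[LHS]tr1 !trmx_mul !trmxK -PT mulmxA.
rewrite ctD ctZ ci !cmx_ct !mulmxDl !mulmxDr -!scalemxAl -!scalemxAr -!map_mxM yPx.
rewrite scalerA mulNr -expr2 sqr_i opprK scale1r.
by rewrite scaleNr addrA addrK -map_mxD !mxE.
Qed.

Lemma complex_colE (z : 'cV[R[i]]_n) :
  z = cmx (map_mx (@complex.Re R) z) + 'i%C *: cmx (map_mx (@complex.Im R) z).
Proof. by apply/matrixP => i j; rewrite !mxE -complexE. Qed.

Hypothesis Ppsd : psd_symmetric P.

Lemma psd_symmetric_hermitian : psd_hermitian (cmx P).
Proof.
have [PT Pge0] := Ppsd; split=> [|z]; first by rewrite cmx_ct -PT.
by rewrite [z]complex_colE hermitian_formE // ler0c addr_ge0.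
Qed.

Lemma psd_form_eq0 (x : 'cV[R]_n) : (x^T *m P *m x) 0 0 = 0 -> P *m x = 0.
Proof.
have [PT Pge0] := Ppsd; move=> x0.
pose y := P *m x; pose c := (y^T *m P *m y) 0 0; pose d := (y^T *m y) 0 0.
have dE : d = \sum_i y i 0 ^+ 2.
  by rewrite /d mxE; apply: eq_bigr => i _; rewrite mxE expr2.
have c0 : 0 <= c by exact: Pge0.
have d0 : 0 <= d by rewrite dE sumr_ge0 // => i _; rewrite sqr_ge0.
have yPx : (y^T *m P *m x) 0 0 = d by rewrite -mulmxA.
have xPy : (x^T *m P *m y) 0 0 = d.
  by rewrite /d {2}/y trmx_mul -PT.
have ineq t : 0 <= - (2 * t * d) + t ^+ 2 * c.
  have := Pge0 (x - t *: y).
  have -> : (x - t *: y)^T = x^T - t *: y^T by apply/matrixP => i j; rewrite !mxE.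
  rewrite !mulmxBl !mulmxBr -!scalemxAl -!scalemxAr !scalerA.
  have ME (X Y Z W : 'M[R]_1) : (X - Y - (Z - W)) 0 0 = X 0 0 - Y 0 0 - (Z 0 0 - W 0 0).
    by rewrite !mxE.
  have SE a (X : 'M[R]_1) : (a *: X) 0 0 = a * X 0 0 by rewrite mxE.
  rewrite ME !SE x0 yPx xPy -/c; set u := (X in 0 <= X -> _); set v := (X in _ -> 0 <= X).
  by have -> : u = v by rewrite /u /v; ring.
have d_eq0 : d = 0.
  apply/eqP; rewrite eq_le d0 andbT leNgt; apply/negP => dgt0.
  (* With [y = P x], the form at [x - t y] is [c t^2 - 2 d t], where [d] is the squared norm of [y];
     this value of [t] makes it negative when [d > 0], including when [c = 0]. *)
  have := ineq (d / (c + d)); have cd : 0 < c + d by rewrite ltr_wpDl.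
  have -> : - (2 * (d / (c + d)) * d) + (d / (c + d)) ^+ 2 * c =
            - (d ^+ 2 * (c + 2 * d) / (c + d) ^+ 2).
    by field; rewrite gt_eqF.
  rewrite oppr_ge0 leNgt => /negP; apply.
  by rewrite divr_gt0 ?exprn_gt0 // mulr_gt0 ?exprn_gt0 // ltr_wpDl // mulr_gt0.
apply/matrixP => i j; rewrite ord1 [RHS]mxE -/y.
move/eqP: d_eq0; rewrite dE psumr_eq0 => [|k _]; last exact: sqr_ge0.
move=> /allP/(_ i (mem_index_enum i)).
by rewrite sqrf_eq0 => /eqP.
Qed.

Lemma psd_hermitian_form_eq0 k (Z : 'M[R[i]]_(n, k)) :
  Z^t* *m cmx P *m Z = 0 -> cmx P *m Z = 0.
Proof.
have [PT Pge0] := Ppsd; move=> Z0; apply/matrixP => i j.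
pose y : 'cV_n := Z *m delta_mx j 0.
suff : cmx P *m y = 0.
  by rewrite mulmxA -colE => /matrixP/(_ i 0); rewrite !mxE.
have : (y^t* *m cmx P *m y) 0 0 = 0.
  rewrite ctM -mulmxA -mulmxA (mulmxA (cmx P)) (mulmxA (Z^t*)) (mulmxA (Z^t*)) Z0.
  by rewrite mul0mx mulmx0 mxE.
rewrite [y]complex_colE hermitian_formE // => /complexI/eqP.
rewrite paddr_eq0 // => /andP[/eqP/psd_form_eq0 Px /eqP/psd_form_eq0 Py].
by rewrite mulmxDr -scalemxAr -!map_mxM Px Py !map_mx0 scaler0 addr0.
Qed.

End Positivity.

Section Congruence.
Variables (R : realType) (n m : nat).

Lemma psd_hermitian_congr (P : 'M[R[i]]_n) (Z : 'M[R[i]]_(n, m)) :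
  psd_hermitian P -> psd_hermitian (Z^t* *m P *m Z).
Proof.
move=> [PH P0]; split=> [|x]; first by rewrite !ctM ctK PH mulmxA.
by have := P0 (Z *m x); rewrite ctM !mulmxA.
Qed.

Lemma psd_hermitianZ (a : R[i]) (P : 'M[R[i]]_n) : 0 <= a ->
  psd_hermitian P -> psd_hermitian (a *: P).
Proof.
move=> a0 [PH P0]; split=> [|x]; first by rewrite ctZ PH geC0_conj.
by rewrite -scalemxAr -scalemxAl mxE mulr_ge0.
Qed.

End Congruence.

(** * Spectral projections of [B] and the residues of [G] *)

Lemma ker_span (K : fieldType) n m (A : 'M[K]_n.+1) (B : 'M[K]_(n.+1, m)) (q : {poly K})
    (z : 'cV[K]_n.+1) :
  \rank (\mxrow_(k < n.+1) (A ^+ k *m B)) = n.+1 ->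
  exists u : 'I_n.+1 -> 'cV[K]_m,
    horner_mx A q *m z = \sum_(k < n.+1) A ^+ k *m (horner_mx A q *m B *m u k).
Proof.
move=> /controllable_span[V V1]; exists (fun k => V k *m z).
rewrite -[z in LHS]mul1mx -V1 mulmx_suml mulmx_sumr; apply: eq_bigr => k _.
rewrite !mulmxA; do 3![congr (_ *m _)].
have /comm_mx_horner : comm_mx (A ^+ k) A by rewrite /comm_mx mulmxE -exprSr exprS.
by move=> /(_ q) ->.
Qed.

(** Only the coefficients of degree 0 and 1 of [q] act on [X], and an even polynomial has no linear
    term. *)
Lemma horner_mx_even_nilpotent (K : numDomainType) n k (A : 'M[K]_n.+1)
    (X : 'M[K]_(n.+1, k)) (q : {poly K}) :
  q \Po - 'X = q -> A *m A *m X = 0 -> horner_mx A q *m X = q.[0] *: X.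
Proof.
move=> qN AAX.
have q1 : q`_1 = 0.
  have := congr1 (fun p : {poly K} => p^`().[0]) qN.
  rewrite deriv_comp derivN derivX hornerM horner_comp !hornerN hornerX hornerC oppr0 mulrN1.
  rewrite horner_coef0 coef_deriv mulr1n => /eqP.
  by rewrite eq_sym -subr_eq0 opprK -mulr2n mulrn_eq0 /= => /eqP.
have gen p : horner_mx A p *m X = p`_0 *: X + p`_1 *: (A *m X).
  elim/poly_ind: p => [|p c _]; first by rewrite raddf0 !coef0 !scale0r mul0mx addr0.
  rewrite horner_mxMXaddC mulmxDl -mulmxA (horner_mx_eigen (l := 0)) ?mulmxA ?AAX ?scale0r //.
  by rewrite mul_scalar_mx !coefD !coefMX !coefC /= add0r addr0 horner_coef0 addrC.
by rewrite gen q1 scale0r addr0 horner_coef0.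
Qed.

Section ResiduesAtImaginaryPoles.
Variables (R : realType) (n m : nat).
Local Notation cmx := (map_mx (real_complex R)).
Variables (A P : 'M[R]_n.+1) (B : 'M[R]_(n.+1, m)) (C : 'M[R]_(m, n.+1)).
Variables (D : 'M[R]_m) (G : 'M[ratfun R]_m).
Hypotheses (GE : realization A B C D G) (ctr : controllable A B).
Hypotheses (PA : P *m A + A^T *m P = 0) (BP : B^T *m P = C *m A).

(* [Z] is the image of [B] under the spectral projection of [A] at [iw]. *)
Lemma residue_jw (p : {poly R}) (chi : {poly R[i]}) (w : R) :
  horner_mx A p = 0 -> cpoly p = ('X - (jw w)%:P) * chi -> chi.[jw w] != 0 -> w != 0 ->
  exists Z : 'M[R[i]]_(n.+1, m),
    [/\ (s - jw w) *: ('i%C *: tfval G s) @[s --> (jw w)^'] -->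
          (w^-1)%:C *: (Z^t* *m cmx P *m Z),
        cmx A *m Z = jw w *: Z
      & forall z : 'cV[R[i]]_n.+1, cmx A *m z = jw w *: z -> exists u, z = Z *m u].
Proof.
move=> pA pE chiw w0; set H := horner_mx (cmx A) chi.
have AH : cmx A *m H = jw w *: H.
  have : horner_mx (cmx A) (cpoly p) = 0 by rewrite -map_horner_mx pA map_mx0.
  rewrite pE rmorphM rmorphB /= horner_mx_X horner_mx_C => /eqP.
  by rewrite -[_ * _]/(_ *m _) mulmxBl mul_scalar_mx subr_eq0 => /eqP.
pose Z := chi.[jw w]^-1 *: (H *m cmx B).
have ZE : chi.[jw w] *: Z = H *m cmx B by rewrite scalerA mulfV // scale1r.
have AZ : cmx A *m Z = jw w *: Z.
  by rewrite -scalemxAr mulmxA AH -scalemxAl !scalerA mulrC.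
(* [residue_form] evaluates [iw C Z]; dividing by [w] leaves [i C Z]. *)
have CZ : 'i%C *: (cmx C *m Z) = (w^-1)%:C *: (Z^t* *m cmx P *m Z).
  rewrite -(residue_form PA BP chiw ZE AZ) scalerA jwE mulrCA -rmorphM mulVf //.
  by rewrite rmorph1 mulr1.
exists Z; split; [|exact: AZ|move=> z Az].
  have pE1 : cpoly p = ('X - (jw w)%:P) ^+ 1 * chi by rewrite expr1.
  have UE : char_poly_mx (cmx A) *m map_mx polyC H = ('X - (jw w)%:P) ^+ 1 *: map_mx polyC H.
    rewrite expr1 /char_poly_mx mulmxBl mul_scalar_mx -map_mxM AH scalerBl.
    by congr (_ - _); rewrite map_mxZ.
  have FE s : (s - jw w) *: ('i%C *: tfval G s) = 'i%C *: ((s - jw w) ^+ 1 *: tfval G s).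
    by rewrite expr1 !scalerA mulrC.
  have := tfval_cvg (e := 1%N) GE pA isT pE1 chiw UE FE.
  by rewrite map_horner_polyC -mulmxA scalemxAr -/Z CZ.
have ctrC : \rank (\mxrow_(k < n.+1) (cmx A ^+ k *m cmx B)) = n.+1.
  rewrite -[RHS]ctr -(mxrank_map (real_complex R)); congr (\rank _).
  have -> : map_mx (real_complex R) (\mxrow_(k < n.+1) (A ^+ k *m B)) =
            \mxrow_(k < n.+1) cmx (A ^+ k *m B) by apply/matrixP => i j; rewrite !mxE.
  by apply: eq_mxrow => k; rewrite map_mxM rmorphXn.
(* On an eigenvector [chi(A)] is the nonzero scalar [chi(iw)], so [z] is a combination of the
   [A^k Z], each of which is a multiple of [Z]. *)
have [u] := ker_span chi z ctrC.
rewrite (horner_mx_eigen _ Az) -/H -ZE => zE.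
exists (\sum_(k < n.+1) jw w ^+ k *: u k); apply: (scalerI chiw); rewrite zE.
rewrite mulmx_sumr scaler_sumr; apply: eq_bigr => k _.
rewrite -scalemxAl -!scalemxAr mulmxA; congr (_ *: _).
have AlZ l : cmx A ^+ l *m Z = jw w ^+ l *: Z.
  elim: l => [|l IH]; first by rewrite !expr0 mul1mx scale1r.
  rewrite exprS -mulmxE -mulmxA IH -scalemxAr AZ scalerA.
  by rewrite exprSr.
by rewrite AlZ -scalemxAl.
Qed.

(** The analogue at 0, where [Z] projects [B] onto the kernel of [A^2]. There the [A^k Z] no longer
    collapse to [Z]: the terms with [k > 0] leave a remainder in [A ker(A^2)]. *)
Lemma residue_0 (chi : {poly R}) :
  horner_mx A ('X^2 * chi) = 0 -> chi \Po - 'X = chi -> chi.[0] != 0 ->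
  exists Z : 'M[R]_(n.+1, m),
    [/\ s ^+ 2 *: tfval G s @[s --> (0 : R[i])^'] --> cmx (Z^T *m P *m Z),
        forall k, (3 <= k)%N ->
          s ^+ k *: tfval G s @[s --> (0 : R[i])^'] --> (0 : 'M[R[i]]_m)
      & forall x : 'cV[R]_n.+1, A *m A *m x = 0 ->
          exists u v, x = Z *m u + A *m v /\ A *m A *m v = 0].
Proof.
move=> pA chiN chi0; set H := horner_mx A chi.
have AAH : A *m A *m H = 0.
  by move: pA; rewrite rmorphM rmorphXn /= horner_mx_X expr2.
pose Z := chi.[0]^-1 *: (H *m B).
have ZE : chi.[0] *: Z = H *m B by rewrite scalerA mulfV // scale1r.
have AAZ : A *m A *m Z = 0 by rewrite -scalemxAr mulmxA AAH mul0mx scaler0.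
have Hker k (X : 'M[R]_(n.+1, k)) : A *m A *m X = 0 -> H *m X = chi.[0] *: X.
  exact: horner_mx_even_nilpotent.
(* [C A Z = B^T P Z]; as [chi] is even, [chi(A)] is self-adjoint for [P] and acts on [Z] as
   [chi(0)], so [B] may be replaced by [Z] on the left. *)
have CZ : C *m A *m Z = Z^T *m P *m Z.
  have ZTE : chi.[0] *: Z^T = B^T *m H^T by rewrite -linearZ /= ZE trmx_mul.
  rewrite -BP; apply: (scalerI chi0); rewrite -(mulmxA (Z^T)) [RHS]scalemxAl ZTE mulmxA.
  rewrite trmx_horner_mx -(mulmxA B^T (horner_mx _ _)).
  rewrite (horner_mx_intertwine (A := A)) ?chiN; last first.
    by rewrite addrC PA.
  by rewrite -!mulmxA Hker // -!scalemxAr.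
have chic : (cpoly chi).[0] = (chi.[0])%:C.
  by rewrite -(rmorph0 (real_complex R)) horner_map.
have lim k : (2 <= k)%N -> s ^+ k *: tfval G s @[s --> (0 : R[i])^'] -->
    cmx (if k == 2%N then Z^T *m P *m Z else 0).
  (* Since [A^2 chi(A) = 0], one has [(x - A)(x + A) chi(A) = x^2 chi(A)]. The factor [x^(k-2)]
     treats all orders at once: at 0 only [k = 2] survives and leaves [A chi(A)]. *)
  move=> k2; pose U := 'X^(k - 2) *: (('X%:M + map_mx polyC (cmx A)) *m map_mx polyC (cmx H)).
  have pA' : horner_mx A ('X^k * chi) = 0.
    by rewrite -(subnK k2) exprD -mulrA (rmorphM (horner_mx A)) /= pA mulr0.
  have pE : cpoly ('X^k * chi) = ('X - 0%:P) ^+ k * cpoly chi.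
    by rewrite cpolyM subr0 /cpoly map_polyXn.
  have chi0' : (cpoly chi).[0] != 0 by rewrite chic eq_complex /= eqxx andbT.
  have UE : char_poly_mx (cmx A) *m U =
      ('X - 0%:P) ^+ k *: map_mx polyC (horner_mx (cmx A) (cpoly chi)).
    rewrite -map_horner_mx -/H /U -scalemxAr mulmxA subr0 -[in RHS](subnK k2) exprD.
    rewrite -scalerA; congr (_ *: _); rewrite /char_poly_mx mulmxBl !mulmxDr.
    rewrite -scalar_mxM scalar_mxC opprD addrA addrK mulmxBl mul_scalar_mx.
    by rewrite -!map_mxM AAH !map_mx0 subr0.
  have FE s : s ^+ k *: tfval G s = 1 *: ((s - 0) ^+ k *: tfval G s).
    by rewrite subr0 scale1r.
  have := tfval_cvg (e := k) GE pA' (ltnW k2) pE chi0' UE FE.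
  suff -> : 1 *: ((cpoly chi).[0]^-1 *: (cmx C *m map_mx (horner_eval 0) U *m cmx B)) =
    cmx (if k == 2%N then Z^T *m P *m Z else 0) by [].
  have X0 : horner_eval (0 : R[i]) 'X^(k - 2) = (k == 2%N)%:R.
    by rewrite /horner_eval hornerXn expr0n subn_eq0 eqn_leq k2 andbT.
  have X1 : horner_eval (0 : R[i]) 'X = 0 by rewrite /horner_eval hornerX.
  rewrite scale1r /U map_mxZ /= X0; case: ifP => _; last first.
    by rewrite scale0r mulmx0 mul0mx map_mx0 scaler0.
  rewrite scale1r mulmxDl mul_scalar_mx -map_mxM map_mxD map_mxZ !map_horner_polyC.
  rewrite /= X1 scale0r add0r -CZ chic -fmorphV -!map_mxM -map_mxZ.
  by rewrite -!scalemxAr !mulmxA.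
exists Z; split=> [|k k3|x AAx].
  exact: (lim 2%N).
  have k2 : (k == 2%N) = false by rewrite gtn_eqF.
  have := lim k (ltnW k3); rewrite k2 map_mx0.
  exact: id.
have [u] := ker_span chi x ctr; rewrite Hker // -/H -ZE big_ord_recl.
have -> : \sum_(i < n) A ^+ lift ord0 i *m (chi.[0] *: Z *m u (lift ord0 i)) =
   chi.[0] *: (A *m \sum_(i < n) A ^+ i *m (Z *m u (lift ord0 i))).
  rewrite mulmx_sumr scaler_sumr; apply: eq_bigr => i _.
  by rewrite lift0 exprS -mulmxE -!scalemxAl -!scalemxAr !mulmxA.
rewrite expr0 mul1mx -scalemxAl -scalerDr => /(scalerI chi0) ->.
exists (u ord0), (\sum_(i < n) A ^+ i *m (Z *m u (lift ord0 i))); split=> //.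
rewrite mulmx_sumr big1 // => i _; rewrite !mulmxA.
have -> : A *m A *m A ^+ i = A ^+ i *m (A *m A).
  by rewrite !mulmxE -expr2 -!exprD addnC.
by rewrite -(mulmxA (A ^+ i)) AAZ mulmx0 mul0mx.
Qed.

End ResiduesAtImaginaryPoles.

(** * Positivity of [P] from its restrictions to the kernels of [A^2 + w^2] *)

Section PositivityOnKernels.
Variables (R : realType) (n : nat) (A P : 'M[R]_n.+1).
Hypotheses (PA : P *m A + A^T *m P = 0) (PT : P^T = P).

Lemma horner_imdenom_eigen a (ws : seq R) (y : 'cV[R]_n.+1) : A *m (A *m y) = a *: y ->
  horner_mx A (imdenom ws) *m y = (\prod_(v <- ws) (a + v ^+ 2)) *: y.
Proof.
move=> Ay; elim: ws => [|w ws IH].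
  by rewrite /imdenom !big_nil rmorph1 mul1mx scale1r.
rewrite /imdenom !big_cons rmorphM /= -mulmxE -mulmxA -/(imdenom _) IH -scalemxAr.
rewrite rmorphD rmorphXn /= horner_mx_X horner_mx_C mulmxDl expr2 -mulmxE -mulmxA Ay.
by rewrite mul_scalar_mx -scalerDl scalerA mulrC.
Qed.

(** The kernel of [imdenom ws] at [A] is the sum of the kernels of [A^2 + w^2], and these are
    orthogonal for [P]; one of them is split off at each step. *)
Lemma psd_on_imdenom_ker (ws : seq R) :
  uniq ws -> (forall w, w \in ws -> 0 <= w) ->
  (forall w (x : 'cV[R]_n.+1), w \in ws -> A *m (A *m x) = - w ^+ 2 *: x ->
     0 <= (x^T *m P *m x) 0 0) ->
  forall x : 'cV[R]_n.+1, horner_mx A (imdenom ws) *m x = 0 -> 0 <= (x^T *m P *m x) 0 0.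
Proof.
elim: ws => [|w ws IH] /= uws ws0 Pws x qx.
  by move: qx; rewrite /imdenom big_nil rmorph1 mul1mx => ->; rewrite mulmx0 mxE.
move: uws => /andP[wws uws].
pose q := imdenom ws; pose y := horner_mx A q *m x.
pose c := \prod_(v <- ws) (- w ^+ 2 + v ^+ 2).
(* The numbers [w :: ws] are distinct and nonnegative, so their squares are distinct. *)
have c0 : c != 0.
  rewrite prodf_seq_neq0; apply/allP => v vws /=; rewrite addrC subr_eq0.
  rewrite eqrXn2 ?ws0 ?inE ?eqxx ?vws ?orbT //.
  by apply: contraNneq wws => <-.
have Ay : A *m (A *m y) = - w ^+ 2 *: y.
  move: qx; rewrite /imdenom big_cons rmorphM /= -mulmxE -mulmxA -/(imdenom _) -/q -/y.
  rewrite rmorphD rmorphXn /= horner_mx_X horner_mx_C mulmxDl expr2 -mulmxE -mulmxA.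
  by move=> /eqP; rewrite mul_scalar_mx addr_eq0 -scaleNr => /eqP.
have qy : horner_mx A q *m y = c *: y by exact: horner_imdenom_eigen.
(* [q(A)] kills the components of [x] belonging to [ws] and multiplies the one belonging to [w] by
   [c]; thus [x1] is that component. *)
pose x1 := c^-1 *: y; pose x2 := x - x1.
have qx1 : horner_mx A q *m x1 = y by rewrite -scalemxAr qy scalerA mulVf // scale1r.
have qx2 : horner_mx A q *m x2 = 0 by rewrite mulmxBr qx1 subrr.
have Ax1 : A *m (A *m x1) = - w ^+ 2 *: x1.
  by rewrite -!scalemxAr Ay !scalerA mulrC.
(* [q] is even, so [q(A)] is self-adjoint for [P]; it scales [x1] by [c] and kills [x2]. *)
have cross : x1^T *m P *m x2 = 0.
  apply: (scalerI c0); rewrite scaler0 -mulmxA scalemxAl -linearZ /= scalerA mulfV //.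
  rewrite scale1r -qx1 trmx_mul trmx_horner_mx -!mulmxA (mulmxA (horner_mx A^T q)).
  rewrite (@horner_mx_intertwine _ _ A) ?imdenom_even; last by rewrite addrC PA.
  by rewrite -mulmxA qx2 !mulmx0.
have cross' : x2^T *m P *m x1 = 0.
  by apply: trmx_inj; rewrite trmx0 !trmx_mul trmxK PT mulmxA.
have orth (u v : 'cV[R]_n.+1) : u^T *m P *m v = 0 -> v^T *m P *m u = 0 ->
    ((u + v)^T *m P *m (u + v)) 0 0 = (u^T *m P *m u) 0 0 + (v^T *m P *m v) 0 0.
  by move=> uv vu; rewrite [(u + v)^T]linearD /= !mulmxDl !mulmxDr uv vu addr0 add0r mxE.
have -> : x = x1 + x2 by rewrite addrC subrK.
rewrite orth // addr_ge0 //.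
  by apply: Pws Ax1; rewrite inE eqxx.
apply: IH => // [v vws|v z vws]; first by rewrite ws0 // inE vws orbT.
by apply: Pws; rewrite inE vws orbT.
Qed.

End PositivityOnKernels.

Section PositivityAtPoles.
Variables (R : realType) (n m : nat).
Local Notation cmx := (map_mx (real_complex R)).
Variables (A P : 'M[R]_n.+1).
Hypotheses (PA : P *m A + A^T *m P = 0) (PT : P^T = P).

(* [z = x - (i/w) A x] is an eigenvector of [A] for [iw], and [z^* P z = 2 x^T P x]. *)
Lemma psd_on_quadratic_ker (w : R) (x : 'cV[R]_n.+1) : 0 < w ->
  A *m (A *m x) = - w ^+ 2 *: x ->
  (forall z : 'cV[R[i]]_n.+1, cmx A *m z = jw w *: z -> 0 <= (z^t* *m cmx P *m z) 0 0) ->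
  0 <= (x^T *m P *m x) 0 0.
Proof.
move=> w0 Ax Pz; have wn0 : w != 0 by rewrite gt_eqF.
pose y := - w^-1 *: (A *m x).
have yPy : y^T *m P *m y = x^T *m P *m x.
  have yT : y^T = - w^-1 *: (x^T *m A^T) by rewrite linearZ /= trmx_mul.
  have key : x^T *m A^T *m P *m (A *m x) = w ^+ 2 *: (x^T *m P *m x).
    have /eqP := PA; rewrite addrC addr_eq0 => /eqP ATP.
    rewrite -(mulmxA (x^T) A^T) ATP mulmxN mulNmx (mulmxA (x^T) P A) -(mulmxA (x^T *m P) A) Ax.
    by rewrite -scalemxAr scaleNr opprK.
  rewrite yT /y -!scalemxAl -!scalemxAr key !scalerA mulrNN -invfM -expr2.
  by rewrite mulVf ?expf_neq0 // scale1r.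
have := Pz (cmx x + 'i%C *: cmx y).
rewrite (hermitian_formE _ _ (esym PT)) yPy ler0c -mulr2n pmulrn_lge0 //; apply.
have Axy : A *m x = - w *: y by rewrite /y scalerA mulrNN mulfV // scale1r.
have Ayx : A *m y = w *: x.
  by rewrite /y -scalemxAr Ax scalerA mulrNN expr2 mulKf.
rewrite mulmxDr -scalemxAr -!map_mxM Axy Ayx !map_mxZ /= rmorphN /=.
by rewrite scalerDr !scalerA jwE (mulrAC 'i%C w%:C) -expr2 sqr_i mulN1r addrC.
Qed.

End PositivityAtPoles.

(** * Necessity *)

Lemma block_diag_mxX (K : comNzRingType) n1 n2 (X : 'M[K]_n1.+1) (Y : 'M[K]_n2.+1) l :
  (block_mx X 0 0 Y : 'M[K]_((n1 + n2.+1).+1)) ^+ l = block_mx (X ^+ l) 0 0 (Y ^+ l).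
Proof.
elim: l => [|l IH]; first by rewrite !expr0 -scalar_mx_block.
rewrite exprS IH -[LHS]/(block_mx X 0 0 Y *m block_mx (X ^+ l) 0 0 (Y ^+ l)).
by rewrite mulmx_block !(mul0mx, mulmx0, addr0, add0r) !exprS.
Qed.

Section LosslessMarkov.
Variables (R : realType) (n m : nat).
Local Notation cmx := (map_mx (real_complex R)).
Variables (A : 'M[R]_n.+1) (B : 'M[R]_(n.+1, m)) (C : 'M[R]_(m, n.+1)).
Variables (D : 'M[R]_m) (G : 'M[ratfun R]_m).
Hypotheses (GE : realization A B C D G).

Let psi0 : char_poly A != 0 := monic_neq0 (char_poly_monic A).

Lemma markov_parameters_imaginary_axis k (A' : 'M[R[i]]_k.+1) (B' : 'M[R[i]]_(k.+1, m))
    (E : 'M[R[i]]_(m, k.+1)) (W : 'M[{poly R[i]}]_m) :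
  (forall w Y, 0 < w -> (cpoly (char_poly A)).[jw w] != 0 ->
     ((jw w)%:M - A') *m Y = B' ->
     E *m Y + map_mx (horner_eval (jw w)) W = 0) ->
  W = 0 /\ forall l, E *m A' ^+ l *m B' = 0.
Proof.
move=> EW; apply: (markov_parameters_eq0
  (S := fun s => exists w, [/\ 0 < w, s = jw w & (cpoly (char_poly A)).[s] != 0])).
  by move=> p; apply: imaginary_axis_infinite; rewrite cpoly_eq0.
by move=> s Y [w [w0 -> ps]] _; apply: EW.
Qed.

(** [G(s) - G(-s)^T] is realized by the block diagonal matrix of [A] and [-A^T], with input
    [(B; C^T)], output [(C, B^T)] and constant term [D - D^T]. It vanishes along the imaginary axis,
    so its constant term and Markov parameters are zero. *)
Lemma lossless_markov :
  (forall w, 0 < w -> (cpoly (char_poly A)).[jw w] != 0 -> jskew G w = 0) ->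
  D = D^T /\ forall l, C *m A ^+ l *m B + B^T *m (- A^T) ^+ l *m C^T = 0.
Proof.
move=> Gw.
have [] := @markov_parameters_imaginary_axis (n + n.+1)
  (block_mx (cmx A) 0 0 (- cmx A^T)) (col_mx (cmx B) (cmx C^T))
  (row_mx (cmx C) (cmx B^T)) (map_mx polyC (cmx (D - D^T))).
  move=> w Y w0 pw; rewrite map_horner_polyC.
  have [Y1 [Y2 ->]] : exists Y1 Y2 : 'M[R[i]]_(n.+1, m), Y = col_mx Y1 Y2.
    exists (usubmx (Y : 'M[R[i]]_(n.+1 + n.+1, m))), (dsubmx (Y : 'M[R[i]]_(n.+1 + n.+1, m))).
    by rewrite [RHS]vsubmxK.
  have -> : (jw w)%:M - block_mx (cmx A) 0 0 (- cmx A^T) =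
      block_mx ((jw w)%:M - cmx A) 0 0 ((jw w)%:M + cmx A^T) :> 'M[R[i]]_(n.+1 + n.+1).
    by rewrite scalar_mx_block opp_block_mx add_block_mx !oppr0 !addr0 opprK.
  rewrite (@mul_block_col _ n.+1 n.+1 n.+1 n.+1 m) !mul0mx addr0 add0r => YB.
  have [Y1B Y2C] := @eq_col_mx _ n.+1 n.+1 m _ _ _ _ YB.
  have GY := realization_tfval GE psi0 (Cayley_Hamilton A) pw Y1B.
  have /jskew_eq0 := Gw w w0 pw; rewrite GY ctD ctM !cmx_ct => GH.
  (* The conjugate transpose of [(s - A) Y1 = B] at [s = iw] is [Y1^* (s + A^T) = - B^T], and
     [C^T = (s + A^T) Y2]. *)
  have YC : Y1^t* *m cmx C^T = - (cmx B^T *m Y2).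
    rewrite -Y2C mulmxA -mulNmx; congr (_ *m _).
    rewrite -(cmx_ct B) -Y1B ctM -mulmxN; congr (_ *m _).
    apply/matrixP => i j; rewrite !mxE rmorphB rmorphMn /= conj_real conj_jw.
    by rewrite eq_sym mulNrn opprB opprK addrC.
  rewrite (@mul_row_col _ m n.+1 n.+1 m) map_mxB addrACA GH YC.
  by rewrite addrACA addNr subrr addr0.
move=> DD EAB; split.
  apply/eqP; rewrite -subr_eq0; apply/eqP; apply: (@cmx_inj R).
  by apply/matrixP => i j; have /matrixP/(_ i j) := DD; rewrite !mxE => /polyC_inj.
move=> l; apply: (@cmx_inj R); have := EAB l.
rewrite block_diag_mxX (@mul_row_block _ m n.+1 n.+1 n.+1 n.+1) !mulmx0 addr0 add0r.
rewrite (@mul_row_col _ m n.+1 n.+1 m) map_mx0 => <-.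
by rewrite map_mxD !map_mxM !rmorphXn /= map_mxN.
Qed.

(** Up to a polynomial matrix, [C q(A) (s - A)^-1 B] is [q G], which is itself polynomial. Being
    strictly proper it vanishes, so [C q(A) A^l B = 0] for all [l]; controllability and
    observability then remove [B] and [C]. *)
Lemma annihilator_rden (q : {poly R}) : controllable A B -> observable A C ->
  (forall i j, rden (G i j) %| q) -> horner_mx A q = 0.
Proof.
move=> ctr obs Gq; set Q := horner_mx A q.
have [N [_ NA _]] := resolvent_numerator (cmx A) (cpoly q).
pose V : 'M[{poly R[i]}]_m :=
  \matrix_(i, j) cpoly (rnum (G i j) * (q %/ rden (G i j))).
have Vs s : ~~ is_pole G s -> map_mx (horner_eval s) V = (cpoly q).[s] *: tfval G s.
  move=> Gs; apply/matrixP => i j; rewrite !mxE /horner_eval /rval.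
  rewrite -{2}(divpK (Gq i j)) !cpolyM !hornerM mulrC -mulrA; congr (_ * _).
  rewrite mulrC divfK //.
  by apply: contra Gs => Gs; apply/is_poleP; exists i, j.
have [] := @markov_parameters_imaginary_axis n (cmx A) (cmx B) (cmx (C *m Q))
  (- V + (cpoly q *: map_mx polyC (cmx D) +
          map_mx polyC (cmx C) *m N *m map_mx polyC (cmx B))).
  move=> w Y w0 pw YB; have GY := realization_tfval GE psi0 (Cayley_Hamilton A) pw YB.
  have Gw : ~~ is_pole G (jw w).
    apply: contra pw; apply: is_pole_dvdp => i j.
    exact: (realization_rden_dvdp GE psi0 (Cayley_Hamilton A)).
  have QY : cmx Q *m Y = (cpoly q).[jw w] *: Y - map_mx (horner_eval (jw w)) N *m cmx B.
    rewrite -YB mulmxA -horner_char_poly_mx -map_mxM NA map_mxB map_scalar_mx.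
    rewrite map_horner_polyC mulmxBl mul_scalar_mx opprB addrC subrK /Q.
    by rewrite map_horner_mx.
  rewrite !map_mxD map_mxN Vs // map_mxZ !map_mxM !map_horner_polyC.
  rewrite -mulmxA QY GY mulmxBr -scalemxAr scalerDr /= /horner_eval mulmxA.
  set a := _ *: (_ *m Y); set b := _ *: cmx D; set c := _ *m cmx B.
  move: a b c => a b c; apply/matrixP => i j; rewrite !mxE; ring.
move=> _ CQ.
have CQ0 : C *m Q = 0.
  apply: (controllable_left_eq0 ctr) => l; apply: (@cmx_inj R).
  by rewrite !map_mxM rmorphXn /= -map_mxM CQ map_mx0.
apply: (observable_right_eq0 obs) => l.
have -> : C *m A ^+ l *m Q = C *m Q *m A ^+ l.
  rewrite -!mulmxA; congr (_ *m _).
  have /(comm_mx_horner q) : comm_mx (A ^+ l) A by rewrite /comm_mx mulmxE -exprSr exprS.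
  exact.
by rewrite CQ0 mul0mx.
Qed.

End LosslessMarkov.

Section Necessity.
Variables (R : realType) (n m : nat).
Local Notation cmx := (map_mx (real_complex R)).
Variables (A : 'M[R]_n.+1) (B : 'M[R]_(n.+1, m)) (C : 'M[R]_(m, n.+1)).
Variables (D : 'M[R]_m) (G : 'M[ratfun R]_m).

Lemma mup_conj (p : {poly R}) z : p != 0 ->
  (mup z (cpoly p) <= mup (Num.conj z) (cpoly p))%N.
Proof.
move=> p0; rewrite mup_geq ?cpoly_eq0 //.
have cp : map_poly Num.conj (cpoly p) = cpoly p.
  by rewrite -map_poly_comp; apply: eq_map_poly => x /=; rewrite conj_real.
have -> : ('X - (Num.conj z)%:P) ^+ mup z (cpoly p) =
          map_poly Num.conj (('X - z%:P) ^+ mup z (cpoly p)).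
  by rewrite rmorphXn rmorphB /= map_polyX map_polyC.
by rewrite -[X in _ %| X]cp dvdp_map -mup_geq ?cpoly_eq0.
Qed.

(** Poles are symmetric about 0 by [lossless_pole_opp], so excluding the open right half-plane also
    excludes the left one. *)
Lemma lossless_poles_imaginary p : p != 0 -> (forall i j, rden (G i j) %| p) ->
  lossless_negative_imaginary G -> forall z, is_pole G z -> complex.Re z = 0.
Proof.
move=> p0 Gp [[noRe _ _ _ _] Gw] z Gz.
have Gpole w : 0 < w -> (cpoly p).[jw w] != 0 -> jskew G w = 0.
  by move=> w0 pw; apply: Gw => //; apply: contra pw; apply: is_pole_dvdp.
have [zlt|zgt|->//] := ltgtP (complex.Re z) 0.
  have /noRe : 0 < complex.Re (- z) by case: (z) zlt => a b /=; rewrite oppr_gt0.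
  by rewrite (lossless_pole_opp p0 Gp Gpole Gz).
by have := noRe z zgt; rewrite Gz.
Qed.

Lemma lossless_imdenom p : p != 0 -> (forall i j, rden (G i j) %| p) ->
  lossless_negative_imaginary G ->
  exists ws : seq R,
    [/\ uniq ws, (forall w, w \in ws -> 0 <= w),
        (forall w, w \in ws -> is_pole G (jw w))
      & forall i j, rden (G i j) %| imdenom ws].
Proof.
move=> p0 Gp LG; have Re0 := lossless_poles_imaginary p0 Gp LG.
(* The roots of [d] are poles of [G], and every pole is among them; [ws] collects the moduli of
   their imaginary parts. *)
pose d := \prod_(k : 'I_m * 'I_m) rden (G k.1 k.2).
have d0 : d != 0 by apply/prodf_neq0 => k _; exact: rden_neq0.
have [r dE] := closed_field_poly_normal (cpoly d).
have dr z : root (cpoly d) z = (z \in r).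
  by rewrite dE rootZ ?root_prod_XsubC // lead_coef_eq0 cpoly_eq0.
have rpole z : z \in r -> is_pole G z.
  rewrite -dr /cpoly rmorph_prod /= rootE horner_prod prodf_seq_eq0 => /hasP[k _ /= rk].
  by apply/is_poleP; exists k.1, k.2.
have conj_pole z : is_pole G z -> is_pole G (Num.conj z).
  move=> /is_poleP[i [j]]; rewrite rootE => /eqP Gz; apply/is_poleP; exists i, j.
  by rewrite rootE -conj_cpoly Gz rmorph0.
have abs_pole z : is_pole G z -> is_pole G (jw `|complex.Im z|).
  move=> Gz; have zE := real_partE (Re0 z Gz); case: (ger0P (complex.Im z)) => _.
    by rewrite -zE.
  have -> : jw (- complex.Im z) = Num.conj z.
    by rewrite [in RHS]zE conj_jw; apply/eqP; rewrite eq_complex /= oppr0 !eqxx.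
  exact: conj_pole.
exists (undup [seq `|complex.Im z| | z <- r]); split; first exact: undup_uniq.
- by move=> w; rewrite mem_undup => /mapP[z _ ->]; exact: normr_ge0.
- by move=> w; rewrite mem_undup => /mapP[z zr ->]; apply: abs_pole; apply: rpole.
move=> i j; apply: dvdp_imdenom; first exact: rden_neq0.
  by move=> w; rewrite mem_undup => /mapP[z _ ->]; exact: normr_ge0.
move=> z rz; have Gz : is_pole G z by apply/is_poleP; exists i, j.
have zE := real_partE (Re0 z Gz).
split; first exact: Re0.
  rewrite mem_undup; apply/mapP; exists z => //; rewrite -dr.
  rewrite /d (bigD1 (i, j)) //= cpolyM rootM rz //.
have [[_ _ P0 Pw _] _] := LG.
have le1 u : 0 < complex.Im u -> is_pole G u -> (mup u (cpoly (rden (G i j))) <= 1)%N.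
  move=> u0 Gu; have uE := real_partE (Re0 u Gu); rewrite uE in Gu *.
  by have [h _] := Pw _ u0 Gu; apply: leq_trans h; apply: mup_le_pole_order.
case: (eqVneq z 0) => [z0|z0].
  rewrite z0 in Gz *; have [h _ _] := P0 Gz.
  by apply: leq_trans h; apply: mup_le_pole_order.
have [zlt|zgt|zI] := ltgtP (complex.Im z) 0; last by move: z0; rewrite zE zI jw_eq0 eqxx.
  (* The simple-pole condition concerns [iw] with [w > 0] only; the lower half of the axis is
     reached by conjugation. *)
  apply: leq_trans (mup_conj z (rden_neq0 _)) _; apply: le1; last exact: conj_pole.
  by rewrite conj_complexE /= oppr_gt0.
exact: le1.
Qed.

Hypotheses (GE : realization A B C D G) (ctr : controllable A B) (obs : observable A C).

Lemma lossless_necessary : lossless_negative_imaginary G ->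
  D = D^T /\ exists P : 'M[R]_n.+1,
    [/\ psd_symmetric P, P *m A + A^T *m P = 0, B^T *m P = C *m A
      & C *m B + (C *m B)^T = 0].
Proof.
move=> LG; have psi0 : char_poly A != 0 := monic_neq0 (char_poly_monic A).
have Gpsi i j : rden (G i j) %| char_poly A.
  exact: realization_rden_dvdp GE psi0 (Cayley_Hamilton A) i j.
have [DD CAB] : D = D^T /\ forall l, C *m A ^+ l *m B + B^T *m (- A^T) ^+ l *m C^T = 0.
  apply: (lossless_markov GE) => w w0 pw; have [_ Gw] := LG; apply: Gw => //.
  by apply: contra pw; apply: is_pole_dvdp.
split=> //.
have [T [TT TA TB]] := skew_similarity ctr CAB.
have BT : B^T *m T = - C.
  by apply: trmx_inj; rewrite trmx_mul trmxK TT mulNmx TB linearN.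
(* This choice is dictated by [B^T P = C A] together with [B^T T = - C]. *)
pose P := - (T *m A).
have PT : P^T = P.
  by rewrite /P linearN /= trmx_mul TT mulmxN opprK TA mulNmx opprK.
have PA : P *m A + A^T *m P = 0.
  rewrite /P mulmxN; apply/eqP; rewrite subr_eq0; apply/eqP.
  by rewrite mulNmx {1}TA !mulNmx opprK mulmxA.
have BP : B^T *m P = C *m A by rewrite /P mulmxN mulmxA BT mulNmx opprK.
exists P; split=> //; last first.
  have -> : C = - (B^T *m T) by rewrite BT opprK.
  by rewrite mulNmx linearN /= !trmx_mul trmxK TT mulNmx mulmxN mulmxA opprK addNr.
split=> [//|x].
have [ws [uws ws0 wspole Gws]] := lossless_imdenom psi0 Gpsi LG.
(* Minimality carries the pole structure of [G] over to [A]. *)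
have QA : horner_mx A (imdenom ws) = 0 by exact: annihilator_rden GE _ ctr obs Gws.
apply: (psd_on_imdenom_ker PA PT uws ws0); last by rewrite QA mul0mx.
move=> w {}x wws Ax; have [[_ _ P0 Pw _] _] := LG.
have [w0|w0] := eqVneq w 0.
  have := imdenom_rem wws; rewrite w0 expr0n /= polyC0 addr0 => QE.
  have [Z [limZ _ Zspan]] : exists Z : 'M[R]_(n.+1, m),
    [/\ s ^+ 2 *: tfval G s @[s --> (0 : R[i])^'] --> cmx (Z^T *m P *m Z),
        forall k, (3 <= k)%N ->
          s ^+ k *: tfval G s @[s --> (0 : R[i])^'] --> (0 : 'M[R[i]]_m)
      & forall x : 'cV[R]_n.+1, A *m A *m x = 0 ->
          exists u v, x = Z *m u + A *m v /\ A *m A *m v = 0].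
    apply: (residue_0 GE ctr PA BP (chi := imdenom (rem 0 ws))).
    - by rewrite -QE.
    - exact: imdenom_even.
    - by apply: imdenom0_neq0; rewrite mem_rem_uniqF.
  have /P0[_ [K limK Kpsd] _] : is_pole G 0.
    by have := wspole w wws; rewrite w0.
  have KE : K = cmx (Z^T *m P *m Z) by exact: cvg_mx_unique limK limZ.
  have AAx : A *m A *m x = 0 by rewrite -mulmxA Ax w0 expr0n oppr0 scale0r.
  have [u [v [xE AAv]]] := Zspan x AAx.
  (* [P A v = - T A^2 v = 0], so the part of [x] outside the span of [Z] does not contribute to the
     form. *)
  have Px : P *m x = P *m (Z *m u).
    by rewrite xE mulmxDr /P [X in _ + X]mulNmx -!mulmxA (mulmxA A A v) AAv mulmx0 oppr0 addr0.
  have -> : x^T *m P *m x = u^T *m (Z^T *m P *m Z) *m u.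
    have xP : x^T *m P = u^T *m Z^T *m P.
      by apply: trmx_inj; rewrite !trmx_mul !trmxK PT Px.
    by rewrite -mulmxA Px !mulmxA xP.
  have [_ /(_ (cmx u))] := Kpsd.
  by rewrite KE cmx_ct -!map_mxM mxE ler0c.
have wgt : 0 < w by rewrite lt_neqAle eq_sym w0 ws0.
have [chi QE chiw] := imdenom_sim ws0 uws wws w0.
have [Z [limZ AZ Zspan]] := residue_jw GE ctr PA BP QA QE chiw w0.
have [_ [K limK [_ Kpsd]]] := Pw w wgt (wspole w wws).
have KE : K = (w^-1)%:C *: (Z^t* *m cmx P *m Z) by exact: cvg_mx_unique limK limZ.
apply: (psd_on_quadratic_ker PA PT wgt Ax) => z /Zspan[u ->].
(* On the eigenspace the form of [P] is [w] times that of the residue [K], which is positive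
   semidefinite. *)
have -> : (Z *m u)^t* *m cmx P *m (Z *m u) = w%:C *: (u^t* *m K *m u).
  rewrite KE ctM -scalemxAr -scalemxAl scalerA -rmorphM mulfV // rmorph1 scale1r.
  by rewrite !mulmxA.
by rewrite mxE mulr_ge0 // ler0c ltW.
Qed.

End Necessity.

(** * Sufficiency *)

Section Sufficiency.
Variables (R : realType) (n m : nat).
Local Notation cmx := (map_mx (real_complex R)).
Variables (A P : 'M[R]_n.+1) (B : 'M[R]_(n.+1, m)) (C : 'M[R]_(m, n.+1)).
Hypotheses (Ppsd : psd_symmetric P) (PA : P *m A + A^T *m P = 0).
Hypotheses (BP : B^T *m P = C *m A) (obs : observable A C).

Let ATP k (X : 'M[R[i]]_(n.+1, k)) :
  cmx A^T *m (cmx P *m X) = - (cmx P *m (cmx A *m X)).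
Proof.
have /eqP := PA; rewrite addrC addr_eq0 => /eqP H.
by rewrite !mulmxA -!map_mxM H map_mxN mulNmx.
Qed.

(** The eigenvector test of observability: [C A^l Z = z^l C Z]. A matrix [Z] is allowed so that
    polynomials in [A] can serve as eigenvectors. *)
Lemma observable_eigen_eq0 k (Z : 'M[R[i]]_(n.+1, k)) z :
  cmx A *m Z = z *: Z -> cmx C *m Z = 0 -> Z = 0.
Proof.
move=> AZ CZ; apply: (@observable_right_eq0 _ _ _ (cmx A) (cmx C)) => [|l].
  rewrite -[RHS]obs -(mxrank_map (real_complex R)); congr (\rank _).
  have -> : map_mx (real_complex R) (\mxcol_(k < n.+1) (C *m A ^+ k)) =
            \mxcol_(k < n.+1) cmx (C *m A ^+ k) by apply/matrixP => i j; rewrite !mxE.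
  by apply: eq_mxcol => j; rewrite map_mxM rmorphXn.
have -> : cmx C *m cmx A ^+ l *m Z = z ^+ l *: (cmx C *m Z).
  rewrite -mulmxA scalemxAr; congr (_ *m _).
  elim: l => [|l IH]; first by rewrite !expr0 mul1mx scale1r.
  by rewrite exprS -mulmxE -mulmxA IH -scalemxAr AZ scalerA exprSr.
by rewrite CZ scaler0.
Qed.

(** A semidefinite form that vanishes on [Z] gives [P Z = 0]; then [z C Z = C A Z = B^T P Z = 0],
    and observability applies. *)
Lemma form_eigen_eq0 k (Z : 'M[R[i]]_(n.+1, k)) z :
  cmx A *m Z = z *: Z -> z != 0 -> Z^t* *m cmx P *m Z = 0 -> Z = 0.
Proof.
move=> AZ z0 /(psd_hermitian_form_eq0 Ppsd) PZ.
apply: (observable_eigen_eq0 AZ); apply: (scalerI z0).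
by rewrite scaler0 scalemxAr -AZ mulmxA -map_mxM -BP map_mxM -mulmxA PZ mulmx0.
Qed.

Lemma eigen_imaginary k (Z : 'M[R[i]]_(n.+1, k)) z :
  cmx A *m Z = z *: Z -> Z != 0 -> complex.Re z = 0.
Proof.
move=> AZ Z0; apply/eqP; apply: contraNT Z0 => Rez; apply/eqP.
apply: (form_eigen_eq0 AZ); first by apply: contraNneq Rez => ->.
have zz : z + Num.conj z != 0.
  by case: (z) Rez => a b /=; apply: contraNneq => -[/eqP]; rewrite -mulr2n mulrn_eq0.
(* Skew-adjointness of [A] yields [(z + conj z) Z^* P Z = 0]. *)
apply: (scalerI zz); rewrite scaler0 scalerDl scalemxAr -AZ !scalemxAl -ctZ -AZ ctM.
by rewrite cmx_ct -!mulmxA ATP mulmxN subrr.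
Qed.

Lemma minpoly_quotient_neq0 (chi : {poly R[i]}) z :
  mxminpoly (cmx A) = ('X - z%:P) * chi -> horner_mx (cmx A) chi != 0.
Proof.
move=> pE; apply/eqP => /mxminpoly_min; rewrite pE => /dvdp_leq.
have chi0 : chi != 0.
  apply: contraTneq (mxminpoly_monic (cmx A)) => chi0.
  by rewrite pE chi0 mulr0 monicE lead_coef0 eq_sym oner_eq0.
by rewrite mulrC size_Mmonic ?monicXsubC // size_XsubC addn2 /= ltnn => /(_ chi0).
Qed.

Lemma minpoly_quotient_eigen (chi : {poly R[i]}) z :
  mxminpoly (cmx A) = ('X - z%:P) * chi ->
  cmx A *m horner_mx (cmx A) chi = z *: horner_mx (cmx A) chi.
Proof.
move=> pE; have := mx_root_minpoly (cmx A).
rewrite pE rmorphM rmorphB /= horner_mx_X horner_mx_C -mulmxE mulmxBl mul_scalar_mx.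
by move=> /eqP; rewrite subr_eq0 => /eqP.
Qed.

Let p0 : mxminpoly A != 0. Proof. exact: monic_neq0 (mxminpoly_monic A). Qed.
Let cpE : cpoly (mxminpoly A) = mxminpoly (cmx A). Proof. exact/esym/mxminpoly_map. Qed.

Lemma minpoly_root_imaginary z : root (cpoly (mxminpoly A)) z -> complex.Re z = 0.
Proof.
rewrite cpE => /factor_theorem[chi]; rewrite mulrC => pE.
apply: (eigen_imaginary (minpoly_quotient_eigen pE)).
exact: minpoly_quotient_neq0 pE.
Qed.

(** Were [(X - z)^2 chi] the minimal polynomial, [Z = (A - z) chi(A)] would be a nonzero
    eigenmatrix. But [z] is imaginary, so the adjoint of [A - z] is [-(A - z)], which kills [Z], and
    the form vanishes on [Z]. *)
Lemma minpoly_mup_imaginary z : z != 0 -> (mup z (cpoly (mxminpoly A)) <= 1)%N.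
Proof.
move=> z0; rewrite mup_leq ?cpoly_eq0 //; apply/negP => /dvdpP[chi pE].
have rz : root (cpoly (mxminpoly A)) z.
  by rewrite pE expr2 !rootM root_XsubC eqxx !orbT.
have zc : Num.conj z = - z.
  by rewrite (real_partE (minpoly_root_imaginary rz)) conj_jw.
rewrite cpE exprS mulrC -mulrA in pE; rewrite expr1 in pE.
have := minpoly_quotient_neq0 pE; have := minpoly_quotient_eigen pE.
set Z := horner_mx _ _ => AZ /eqP; apply; apply: (form_eigen_eq0 AZ z0).
have ZE : Z = cmx A *m horner_mx (cmx A) chi - z *: horner_mx (cmx A) chi.
  by rewrite /Z rmorphM rmorphB /= horner_mx_X horner_mx_C -mulmxE mulmxBl mul_scalar_mx.
rewrite {1}ZE ctD -scaleNr ctZ ctM cmx_ct rmorphN /= zc opprK -mulmxA mulmxDl.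
by rewrite -!mulmxA ATP AZ mulmxN -!scalemxAr -scalemxAl addNr.
Qed.

(** Were [X^3 chi] the minimal polynomial, set [Y = A chi(A)] and [Z = A Y], so that [A Z = 0].
    Skew-adjointness gives first [P Z = 0], then [P Y = 0]; hence [C Z = B^T P Y = 0] and
    observability gives [Z = 0], a contradiction. *)
Lemma minpoly_mup_0 : (mup 0 (cpoly (mxminpoly A)) <= 2)%N.
Proof.
rewrite mup_leq ?cpoly_eq0 //; apply/negP => /dvdpP[chi].
rewrite subr0 cpE exprS mulrC -mulrA -['X](subr0 'X) -polyC0 => pE.
have := minpoly_quotient_neq0 pE; have := minpoly_quotient_eigen pE.
rewrite scale0r; set Z := horner_mx _ _ => AZ /eqP; apply.
pose Y := cmx A *m horner_mx (cmx A) chi.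
have ZE : Z = cmx A *m Y.
  by rewrite /Z polyC0 subr0 rmorphM rmorphXn /= horner_mx_X expr2 -!mulmxE -mulmxA.
have PZ : cmx P *m Z = 0.
  apply: (psd_hermitian_form_eq0 Ppsd).
  by rewrite {1}ZE ctM cmx_ct -!mulmxA ATP AZ !mulmx0 oppr0 mulmx0.
have PY : cmx P *m Y = 0.
  apply: (psd_hermitian_form_eq0 Ppsd).
  by rewrite {1}/Y ctM cmx_ct -!mulmxA ATP -ZE PZ oppr0 mulmx0.
apply: (@observable_eigen_eq0 _ _ 0); first by rewrite scale0r.
by rewrite ZE mulmxA -map_mxM -BP map_mxM -mulmxA PY mulmx0.
Qed.

Lemma imdenom_annihilator : exists ws : seq R,
  [/\ uniq ws, forall w, w \in ws -> 0 <= w & horner_mx A (imdenom ws) = 0].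
Proof.
have [r pE] := closed_field_poly_normal (cpoly (mxminpoly A)).
have ws0 w : w \in undup [seq `|complex.Im z| | z <- r] -> 0 <= w.
  by rewrite mem_undup => /mapP[z _ ->]; exact: normr_ge0.
exists (undup [seq `|complex.Im z| | z <- r]); split=> //; first exact: undup_uniq.
have /mxminpoly_minP // : mxminpoly A %| imdenom (undup [seq `|complex.Im z| | z <- r]).
apply: dvdp_imdenom => // z rz; split; first exact: minpoly_root_imaginary.
  rewrite mem_undup; apply/mapP; exists z => //; move: rz.
  by rewrite pE rootZ ?root_prod_XsubC // lead_coef_eq0 cpoly_eq0.
by case: eqP => [->|/eqP]; [exact: minpoly_mup_0 | exact: minpoly_mup_imaginary].
Qed.

End Sufficiency.

Section LosslessSufficient.
Variables (R : realType) (n m : nat).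
Local Notation cmx := (map_mx (real_complex R)).
Variables (A P : 'M[R]_n.+1) (B : 'M[R]_(n.+1, m)) (C : 'M[R]_(m, n.+1)).
Variables (D : 'M[R]_m) (G : 'M[ratfun R]_m).
Hypotheses (GE : realization A B C D G) (ctr : controllable A B) (obs : observable A C).
Hypotheses (DT : D = D^T) (Ppsd : psd_symmetric P) (PA : P *m A + A^T *m P = 0).
Hypotheses (BP : B^T *m P = C *m A) (CB : C *m B + (C *m B)^T = 0).

(* With [Y = (iw - A)^-1 B], [iw C Y = B^* P Y + C B] is skew-Hermitian. *)
Lemma jskew_annihilator (q : {poly R}) w : horner_mx A q = 0 ->
  0 < w -> (cpoly q).[jw w] != 0 -> jskew G w = 0.
Proof.
move=> qA w0 qw; have q0 : q != 0.
  by apply: contraNneq qw => ->; rewrite /cpoly raddf0 horner0.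
have s0 : jw w != 0 by rewrite jw_eq0 gt_eqF.
set s := jw w in qw s0 *; have sc : Num.conj s = - s by exact: conj_jw.
have [N [NA _ _]] := resolvent_numerator (cmx A) (cpoly q).
rewrite -map_horner_mx qA !map_mx0 subr0 in NA.
have [Y YB] : exists Y, (s%:M - cmx A) *m Y = cmx B.
  exists ((cpoly q).[s]^-1 *: (map_mx (horner_eval s) N *m cmx B)).
  rewrite -scalemxAr mulmxA -horner_char_poly_mx -map_mxM NA map_scalar_mx.
  by rewrite mul_scalar_mx scalerA /= mulVf // scale1r.
have AY : cmx A *m Y = s *: Y - cmx B.
  by rewrite -YB mulmxBl mul_scalar_mx opprB addrC subrK.
apply/jskew_eq0; rewrite (realization_tfval GE q0 qA qw YB) ctD cmx_ct -DT; congr (_ + _).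
have PT : cmx P^T = cmx P by have [<- _] := Ppsd.
pose X := cmx B^T *m cmx P *m Y.
have sCY : s *: (cmx C *m Y) = X + cmx (C *m B).
  by rewrite /X -map_mxM BP map_mxM -mulmxA AY mulmxBr scalemxAr map_mxM subrK.
(* Substituting [B = (s - A) Y] in [B^* P Y] and its conjugate transpose, skew-adjointness of [A]
   and [conj s = - s] give opposite values. *)
have Xct : X^t* = - X.
  have ATP : cmx A^T *m cmx P = - (cmx P *m cmx A).
    by have /eqP := PA; rewrite addrC addr_eq0 => /eqP H; rewrite -!map_mxM H map_mxN.
  have BY : cmx B^T = - (s *: Y^t*) - Y^t* *m cmx A^T.
    rewrite -(cmx_ct B) -YB mulmxBl mul_scalar_mx -mulNmx ctD ctZ sc scaleNr ctM.
    by rewrite -map_mxN cmx_ct linearN /= map_mxN mulmxN.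
  rewrite /X !ctM !cmx_ct trmxK PT {1}BY.
  have -> : cmx B = s *: Y - cmx A *m Y by rewrite AY opprB addrC subrK.
  rewrite !mulmxBr !mulmxBl !mulNmx -!scalemxAl -!scalemxAr opprB opprK addrC.
  by rewrite -(mulmxA (Y^t*) (cmx A^T)) ATP mulmxN mulNmx !mulmxA.
have CBct : (cmx (C *m B))^t* = - cmx (C *m B).
  by rewrite cmx_ct -map_mxN; congr (cmx _); apply/eqP; rewrite -addr_eq0 addrC CB.
(* As [s] is nonzero and imaginary, [s C Y] is skew-Hermitian exactly when [C Y] is Hermitian. *)
apply: (scalerI s0); rewrite [RHS](_ : _ = - (s *: (cmx C *m Y))^t*).
  by rewrite sCY ctD Xct CBct opprD !opprK.
by rewrite ctZ sc scaleNr opprK.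
Qed.

Lemma root_imdenom (ws : seq R) s : root (cpoly (imdenom ws)) s -> complex.Re s = 0.
Proof.
rewrite /cpoly rmorph_prod rootE horner_prod prodf_seq_eq0 => /hasP[w _ /= rw].
have {rw} : root (cpoly ('X^2 + (w ^+ 2)%:P)) s by [].
rewrite cpoly_quadratic rootM root_XsubC -[X in 'X + X]opprK -polyCN root_XsubC.
by case/orP => /eqP -> //=; rewrite oppr0.
Qed.

Lemma mup_XsubC_mul (p chi : {poly R[i]}) z e :
  p = ('X - z%:P) ^+ e * chi -> chi.[z] != 0 -> mup z p = e.
Proof. by move=> -> chiz; rewrite mupMl // mup_XsubCX eqxx. Qed.

Lemma lossless_sufficient : proper_tf G -> lossless_negative_imaginary G.
Proof.
move=> Gprop; have [PT _] := Ppsd.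
have [ws [uws ws0 QA]] := imdenom_annihilator Ppsd PA BP obs.
have Q0 := imdenom_neq0 ws.
have GQ i j : rden (G i j) %| imdenom ws by exact: realization_rden_dvdp GE Q0 QA i j.
have Gskew w : 0 < w -> ~~ is_pole G (jw w) -> jskew G w = 0.
  move=> w0; apply: (jskew_nonpole Q0 GQ) => v v0; exact: jskew_annihilator QA v0.
have rootQ s : is_pole G s -> root (cpoly (imdenom ws)) s by exact: is_pole_dvdp.
split=> //; split.
- move=> s Re_s; apply/negP => /rootQ/root_imdenom Re0.
  by rewrite Re0 ltxx in Re_s.
- move=> w w0 /(Gskew w w0) ->; split=> [|x]; last by rewrite mulmx0 mul0mx mxE.
  by apply/matrixP => i j; rewrite !mxE rmorph0.
- move=> /rootQ; rewrite rootE -(rmorph0 (real_complex R)) horner_map => Q00.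
  have ws00 : 0 \in ws.
    apply: contraTT Q00 => /imdenom0_neq0; apply: contraNN.
    by rewrite eq_complex /= => /andP[].
  have := imdenom_rem ws00; rewrite expr0n /= polyC0 addr0 => QE.
  have chi0 : (imdenom (rem 0 ws)).[0] != 0 by rewrite imdenom0_neq0 // mem_rem_uniqF.
  rewrite QE in QA.
  have [Z [lim2 lim3 _]] := residue_0 GE ctr PA BP QA (imdenom_even _) chi0.
  split.
  + apply: (pole_order_le Q0 GQ).
    rewrite (@mup_XsubC_mul _ (cpoly (imdenom (rem 0 ws))) 0 2) //.
      by rewrite QE cpolyM subr0 /cpoly map_polyXn.
    rewrite -(rmorph0 (real_complex R)) horner_map.
    by apply: contraNneq chi0 => /complexI ->.
  + exists (cmx (Z^T *m P *m Z)) => //.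
    rewrite !map_mxM -cmx_ct; apply: psd_hermitian_congr.
    exact: psd_symmetric_hermitian.
  + exact: lim3.
- move=> w w0 /rootQ Qw.
  have wws : w \in ws.
    by apply: contraTT Qw => wws; rewrite rootE imdenom_jw_neq0 // ltW.
  have wn0 : w != 0 by rewrite gt_eqF.
  have [chi QE chiw] := imdenom_sim ws0 uws wws wn0.
  have [Z [limZ _ _]] := residue_jw GE ctr PA BP QA QE chiw wn0.
  split.
    apply: (pole_order_le Q0 GQ).
    by rewrite (@mup_XsubC_mul _ chi _ 1) // expr1.
  exists ((w^-1)%:C *: (Z^t* *m cmx P *m Z)) => //.
  apply: psd_hermitianZ; first by rewrite ler0c invr_ge0 ltW.
  by apply: psd_hermitian_congr; exact: psd_symmetric_hermitian.
(* Properness of [G] makes the condition at infinity vacuous. *)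
- suff -> : is_pole_infty G = false by [].
  rewrite /is_pole_infty lt0n; apply/negbF; rewrite -leqn0.
  apply/bigmax_leqP => i _; apply/bigmax_leqP => j _.
  by rewrite leqn0 subn_eq0.
Qed.

End LosslessSufficient.

(** * Empty systems and the equivalence *)

Lemma lossless_mx0 (R : realType) (m : nat) (G : 'M[ratfun R]_m) :
  m = 0%N -> lossless_negative_imaginary G.
Proof.
move=> m0; rewrite m0 in G *.
have nopole s : is_pole G s = false by rewrite /is_pole /pole_order big_ord0.
split; last by move=> w _ _; apply/matrixP => -[].
split=> [s _|w _ _|||]; rewrite ?nopole //.
- split=> [|x]; first by apply/matrixP => -[].
  by rewrite [x]flatmx0 mulmx0 mxE.
- by move=> w _; rewrite nopole.
by rewrite /is_pole_infty /pole_order_infty big_ord0.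
Qed.

Theorem theorem1 (R : realType) (m n : nat) (A : 'M[R]_n) (B : 'M[R]_(n, m))
    (C : 'M[R]_(m, n)) (D : 'M[R]_m) (G : 'M[ratfun R]_m) :
  (m <= n)%N ->
  proper_tf G ->
  minimal_realization A B C D G ->
  lossless_negative_imaginary G <->
  D = D^T /\
  exists P : 'M[R]_n,
    psd_symmetric P /\
    block_mx (P *m A + A^T *m P)       (P *m B - A^T *m C^T)
             (B^T *m P - C *m A)       (C *m B + (C *m B)^T) = 0.
Proof.
move=> mn Gprop [GE ctr obs].
(* Polynomials in [A] require a dimension of the form [n.+1]. In dimension 0, [m <= n] leaves only
   empty matrices and both sides hold. *)
case: n => [|n] in A B C mn GE ctr obs *.
  have m0 : m = 0%N by apply/eqP; rewrite -leqn0.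
  split=> _; last exact: lossless_mx0.
  split; first by apply/matrixP => i; exfalso; rewrite m0 in i; case: i.
  exists 0; split; last first.
    by apply/matrixP => i; exfalso; rewrite m0 in i; case: i.
  split=> [|x]; first by rewrite trmx0.
  by rewrite mulmx0 mul0mx mxE.
split=> [LG|[DT [P [Ppsd PE]]]].
  have [DT [P [Ppsd PA BP CB]]] := lossless_necessary GE ctr obs LG.
  split=> //; exists P; split=> //.
  (* The upper right block is the transpose of the lower left one. *)
  have PB : P *m B = A^T *m C^T.
    have [PT _] := Ppsd.
    by apply: trmx_inj; rewrite !trmx_mul !trmxK -PT BP.
  by rewrite PA PB BP CB !subrr block_mx0.
have := PE; rewrite -[0 in RHS]block_mx0 => /eq_block_mx[PA _ BP CB].
move/subr0_eq in BP.
exact: (lossless_sufficient GE ctr obs DT Ppsd PA BP CB).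
Qed.
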